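(* Let $S^1\subset\mathbb{R}^2$ be the unit circle, let $\varphi(a)=1$ for $a>0$ and $\varphi(a)=0$ for $a\le0$, let $\nu$ be a probability measure with support contained in the upper-half unit circle, and put, for $x\in S^1$, $$f(x)=\int\varphi(x^\top w)\,d\nu(w),\qquad f_n(x)=\frac1n\sum_{i=1}^n\varphi(x^\top w_i),\quad w_1,\dots,w_n\in S^1.$$ Let $L(w)=\mathbb{E}_x\left(f_n(x)-f(x)\right)^2$ for $w=[w_1,\dots,w_n]$, where $x$ is drawn uniformly from $S^1$. Then there is a transformation of coordinates $w_i=\Psi(\theta_i)$, with $\Psi:\mathbb{R}\to S^1$ not depending on $n$, such that perturbed gradient descent (PGD) with $n$ particles $\theta_1,\dots,\theta_n$ and step sizes $\gamma_k=1/\sqrt k$ obtains, after $k$ iterations, $w^{(k)}=[w_1^{(k)},\dots,w_n^{(k)}]$ with $w_i^{(k)}=\Psi(\theta_i^{(k)})$ such that $$\mathbb{E}\left[L(w^{(k)})\right]=O\left(\frac{n}{\sqrt k}+\frac1n\right),$$ where the implied constant does not depend on $n$ or $k$ and the expectation is over the algorithmic randomness of PGD.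
   Context: PGD for an objective $G(\theta_1,\dots,\theta_n)$, here $G(\theta)=L(\Psi(\theta_1),\dots,\Psi(\theta_n))$, is the iteration $$\theta_i^{(k+1)}=\theta_i^{(k)}-\gamma_k\left(\partial_{\theta_i}G(\theta^{(k)})+\frac1{\sqrt n}\,\xi_i^{(k)}\right),\qquad k\ge1,$$ where the $\xi_i^{(k)}$ are independent and uniformly distributed on the unit ball of the parameter space ($[-1,1]$ here). It is started from pairwise distinct parameters, at which $G$ is differentiable, in a fixed bounded interval of positive length that does not depend on $n$ or $k$ (chosen together with $\Psi$). *)

(* Defs.v *)
From HB Require Import structures.
From mathcomp Require Import all_boot all_order all_algebra.
From mathcomp Require Import all_classical all_reals all_analysis measurable_realfun.

Set Implicit Arguments.
Unset Strict Implicit.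
Unset Printing Implicit Defensive.

Import Order.TTheory GRing.Theory Num.Theory.
Import numFieldNormedType.Exports.

Local Open Scope classical_set_scope.
Local Open Scope ring_scope.

Definition circle (R : realType) : set (R * R) :=
  [set x | x.1 ^+ 2 + x.2 ^+ 2 = 1].

(* The closed half circle: it contains the end points (1, 0) and (-1, 0). *)
Definition upper_half_circle (R : realType) : set (R * R) :=
  [set x | circle x /\ 0 <= x.2].

Definition dot (R : realType) (x w : R * R) : R := x.1 * w.1 + x.2 * w.2.

Definition step_act (R : realType) (a : R) : R := if 0 < a then 1 else 0.

(* The topological support, i.e. the complement of the union of the open null
   sets. *)
Definition measure_support (R : realType) (nu : probability (R * R)%type R) :
    set (R * R) :=
  [set x | forall U : set (R * R), open U -> U x -> (0 < nu U)%E].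

Lemma lt0_2pi (R : realType) : (0 : R) < pi *+ 2.
Proof. by rewrite mulrn_wgt0// pi_gt0. Qed.

Lemma ltN11 (R : realType) : (-1 : R) < 1.
Proof. by rewrite (lt_trans (ltrN10 R) ltr01). Qed.

Definition circle_point (R : realType) (t : measurableTypeR R) : R * R := (cos t, sin t).

Lemma measurable_circle_point (R : realType) :
  measurable_fun [set: measurableTypeR R] (@circle_point R).
Proof.
apply: measurable_fun_pair; apply: continuous_measurable_fun.
  exact: continuous_cos.
exact: continuous_sin.
Qed.

HB.instance Definition _ (R : realType) :=
  isMeasurableFun.Build _ _ _ _ (@circle_point R) (@measurable_circle_point R).

(* Normalised arc length on the unit circle. *)
Definition circle_uniform (R : realType) : probability (R * R)%type R :=
  distribution (uniform_prob (lt0_2pi R)) (@circle_point R).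

Definition target (R : realType) (nu : probability (R * R)%type R)
    (x : R * R) : R :=
  \int[nu]_w step_act (dot x w).

Definition network (R : realType) (n : nat) (w : 'I_n -> R * R)
    (x : R * R) : R :=
  n%:R^-1 * \sum_(i < n) step_act (dot x (w i)).

Definition loss (R : realType) (nu : probability (R * R)%type R) (n : nat)
    (w : 'I_n -> R * R) : R :=
  \int[circle_uniform R]_x (network w x - target nu x) ^+ 2.

Definition objective (R : realType) (nu : probability (R * R)%type R)
    (Psi : R -> R * R) (n : nat) (theta : 'rV[R]_n) : R :=
  loss nu (fun i => Psi (theta ord0 i)).

(* Mutual independence of the subfamily of X indexed by D. *)
Definition mutually_independent (d : measure_display) (T : measurableType d)
    (R : realType) (P : probability T R) (I : eqType) (D : {pred I})
    (X : I -> T -> R) : Prop :=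
  forall s : seq I, uniq s -> {subset s <= D} ->
  forall B : I -> set R, (forall i, measurable (B i)) ->
  P (\bigcap_(i in [set` s]) (X i @^-1` B i)) =
  (\prod_(i <- s) P (X i @^-1` B i))%E.

(* Iterations are numbered from 1, so xi 0 is left unconstrained. *)
Definition pgd_noise (d : measure_display) (T : measurableType d)
    (R : realType) (P : probability T R) (n : nat)
    (xi : nat -> 'I_n -> {RV P >-> R}) : Prop :=
  mutually_independent P [pred ki : nat * 'I_n | 0 < ki.1]%N
    (fun ki => xi ki.1 ki.2) /\
  forall k i, (0 < k)%N -> forall A : set R, measurable A ->
    distribution P (xi k i) A = uniform_prob (ltN11 R) A.

Definition row_of (T R : Type) (n : nat) (theta : 'I_n -> T -> R)
    (omega : T) : 'rV[R]_n := \row_i theta i omega.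

(* The iterates, whose starting point theta 1 = theta1 is deterministic. The
   recursion is only imposed where G has a gradient, so that the default values
   that 'D takes at other points are irrelevant. *)
Definition pgd_run (d : measure_display) (T : measurableType d)
    (R : realType) (P : probability T R) (n : nat)
    (G : 'rV[R]_n -> R) (gamma : nat -> R) (xi : nat -> 'I_n -> {RV P >-> R})
    (theta1 : 'rV[R]_n) (theta : nat -> 'I_n -> {RV P >-> R}) : Prop :=
  (forall omega, row_of (theta 1%N) omega = theta1) /\
  forall k omega, (0 < k)%N -> differentiable G (row_of (theta k) omega) ->
  forall i, theta k.+1 i omega =
    theta k i omega -
    gamma k * ('D_(delta_mx ord0 i) G (row_of (theta k) omega) +
               (Num.sqrt n%:R)^-1 * xi k i omega).

Definition admissible_start (R : realType) (n : nat) (G : 'rV[R]_n -> R)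
    (a b : R) (theta1 : 'rV[R]_n) : Prop :=
  [/\ injective (theta1 ord0),
      forall i, theta1 ord0 i \in `[a, b] &
      differentiable G theta1].

(* Main.v *)
Require Import Defs.
From HB Require Import structures.
From mathcomp Require Import all_boot all_order all_algebra.
From mathcomp Require Import all_classical all_reals all_analysis.
From mathcomp Require Import perm measurable_realfun ring lra.

(* The folding map [fold t = acos (cos t)] parametrises the upper half circle by
   Psi t = (cos t, |sin t|) = circle_point (fold t).  As E_x phi(x.w) phi(x.v) is
   1/2 - |s - t| / (2 pi) for points of angles s, t in [0, pi], the loss of the
   angles y_i = fold (theta_i) is the energy distance
     c + (1 / (pi n)) sum_i E|y_i - a| - (1 / (2 pi n^2)) sum_ij |y_i - y_j|,
   a being the random angle of nu.  It is invariant under permutations, and convex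
   along the segment joining y to any z that is ordered in the same way as y.
   The squared distance of y to z, minimised over the matchings, is attained by
   such an ordering, so it decreases along PGD as in subgradient descent for a
   convex function; since [fold] is 1-Lipschitz, leaving [0, pi] does no harm.
   Herding gives a z whose energy is at most 2/n, and comparing the iterates with
   z and with earlier iterates bounds the last iterate by
   O(n / sqrt k + 1/n + k^(-1/4)), where k^(-1/4) <= (n / sqrt k + 1/n) / 2.
   Each noise variable is independent of the sigma-algebra of the other ones.
   This makes the noise terms centred, and it makes the iterates almost surely
   avoid the points of non-differentiability (collisions, end points and atoms). *)

Set Implicit Arguments.
Unset Strict Implicit.
Unset Printing Implicit Defensive.

Import Order.TTheory GRing.Theory Num.Theory.
Import numFieldNormedType.Exports.

Local Open Scope classical_set_scope.
Local Open Scope ring_scope.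

(** * Folding the line onto [0, pi] *)

(** The repulsion -|y_i - y_j| is concave, so the loss is not convex in the particles. An absolute
    value is linear on a segment where its argument keeps its sign; hence the targets ordered like
    the current iterate, which optimal matchings supply. The factor n in n / sqrt k is the squared
    matching distance, at most n pi^2. In one step each partial derivative is at most 1/n and each
    scaled noise at most 1/sqrt n, so the n squared displacements add up to at most 4 gamma^2, free
    of n. The bound concerns the last iterate and not an average, which forces the comparison with
    earlier iterates. These are random targets, so the noise has to be centred relative to the past
    and not only on average. The recursion of PGD binds a run only where the gradient exists, and
    the run is only known to be measurable for the ambient sigma-algebra. The analysis is therefore
    made on an auxiliary process, an explicit measurable function of the noise defined everywhere,
    which agrees with the run almost surely. *)

Lemma lipschitz1_continuous (R : realType) (f : R -> R) :
  (forall a b, `|f a - f b| <= `|a - b|) -> continuous f.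
Proof.
move=> lf t; apply/cvgrPdist_le => /= e e0; near=> s.
rewrite (le_trans (lf _ _))//; near: s.
Unshelve. all: by end_near. Qed.

Section fold.
Context {R : realType}.
Implicit Types a b d t : R.

Definition fold t : R := acos (cos t).

Lemma fold_itv t : 0 <= fold t <= pi.
Proof. by rewrite acos_ge0 ?acos_lepi// cos_geN1 cos_le1. Qed.

Lemma cos_fold t : cos (fold t) = cos t.
Proof. by rewrite acosK// in_itv/= cos_geN1 cos_le1. Qed.

Lemma sin_fold t : sin (fold t) = `|sin t|.
Proof. by rewrite sin_acos ?cos_geN1 ?cos_le1// -sin2cos2 sqrtr_sqr. Qed.

Lemma fold_id t : 0 <= t <= pi -> fold t = t.
Proof. by move=> t0; rewrite /fold cosK// in_itv. Qed.

(** The slope of [fold] at t when [sin t] is nonzero; the value 1 at the zeros of the sine is a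
    choice that keeps [fold_unfold] true there. *)
Definition fold_sign t : R := if 0 <= sin t then 1 else -1.

Lemma fold_sign_sqr t : fold_sign t * fold_sign t = 1.
Proof. by rewrite /fold_sign; case: ifP => _; rewrite ?mulr1// mulrNN mulr1. Qed.

(** [fold t] has the cosine of t and the absolute value of its sine, so the addition formula sees
    only the sign of [sin t]. Displacements of the angle thus become displacements on the line, for
    every d. *)
Lemma fold_unfold t d : fold (t + fold_sign t * d) = fold (fold t + d).
Proof.
rewrite /fold /fold_sign; congr acos.
rewrite [RHS]cosD -/(fold t) cos_fold sin_fold.
case: ifPn => [st|]; first by rewrite mul1r cosD ger0_norm.
by rewrite -ltNge => st; rewrite mulN1r cosD cosN sinN ltr0_norm// mulrN mulNr.
Qed.

Lemma fold_lipschitz a b : `|fold a - fold b| <= `|a - b|.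
Proof.
pose d := fold_sign b * (a - b).
have -> : `|a - b| = `|d|.
  rewrite normrM /fold_sign; case: ifP; rewrite ?normrN normr1 mul1r//.
have -> : fold a = fold (fold b + d).
  by rewrite -fold_unfold mulrA fold_sign_sqr mul1r addrC subrK.
have /andP[y0 y1] := fold_itv b; move: (fold b) y0 y1 d => {a b}y y0 y1 d.
have /andP[z0 z1] := fold_itv (y + d).
have pi0 := pi_gt0 R.
(* For |d| < pi the point y + d lies in ]-pi, 2 pi[, and at most one reflection brings it back to
   [0, pi]. *)
have [dpi|dpi] := lerP pi `|d|; first by rewrite ler_norml; lra.
have [yd0|yd0] := ltrP (y + d) 0.
  have -> : fold (y + d) = - (y + d).
    by rewrite /fold -cosN -/(fold _) fold_id//; move: dpi; rewrite ltr_norml; lra.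
  have d0 : d < 0 by lra.
  by rewrite (ltr0_norm d0) ler_norml; lra.
have [yd1|yd1] := ltrP pi (y + d); last first.
  by rewrite fold_id ?yd0// addrAC subrr add0r.
have -> : fold (y + d) = pi *+ 2 - (y + d).
  rewrite /fold -cosN -(cosD2pi (- _)) addrC -/(fold _) fold_id//.
  by move: dpi; rewrite ltr_norml mulr2n; lra.
have d0 : 0 < d by lra.
by rewrite (gtr0_norm d0) ler_norml mulr2n; lra.
Qed.

Lemma continuous_fold : continuous fold.
Proof. exact: lipschitz1_continuous fold_lipschitz. Qed.

Lemma measurable_fold : measurable_fun setT fold.
Proof. exact: continuous_measurable_fun continuous_fold. Qed.

Lemma derivable_fold t : sin t != 0 -> derivable fold t 1.
Proof.
move=> st0.
have c : -1 < cos t < 1.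
  have : (cos t) ^+ 2 < 1.
    by rewrite cos2sin2 ltrBlDr ltrDl exprn_even_gt0.
  by rewrite -[cos t ^+ 2]real_normK ?num_real// expr_lt1// ltr_norml.
apply: diff_derivable; apply: differentiable_comp; apply/derivable1_diffP => //.
Qed.

Lemma measurable_acos : measurable_fun setT (@acos R).
Proof.
have mO : measurable (`]-1, 1[%classic : set R) by exact: measurable_itv.
rewrite -(setUv `]-1, 1[%classic); apply/measurable_funU => //.
  exact: measurableC.
split.
  apply: open_continuous_measurable_fun; first exact: interval_open.
  by move=> x; rewrite inE/= in_itv/= => /continuous_acos.
(* Off ]-1, 1[, [acos] is pi at -1 and 0 elsewhere: at 1 by its true value, beyond by its default
   value. *)
apply: (eq_measurable_fun (fun x : R => pi * (x == -1)%:R)).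
  move=> x; rewrite inE/= in_itv/= => x1.
  have [->|xN1] := eqVneq x (-1); first by rewrite acosN1 mulr1.
  have [->|x11] := eqVneq x 1; first by rewrite acos1 mulr0.
  rewrite mulr0 unlock; case: xgetP => // y _ [_ yx].
  exfalso; apply: x1; rewrite !lt_neqAle eq_sym xN1 x11 -yx cos_geN1 cos_le1.
  by [].
apply: measurable_funM => //.
apply/measurable_funTS.
rewrite (_ : (fun _ => _) = \1_[set (-1 : R)]); last first.
  by apply/funext => x; rewrite indicE in_set1.
exact: measurable_indic.
Qed.

End fold.

(** * Bounded measurable functions *)

Section bounded_measurable.
Context d (T : measurableType d) (R : realType).
Implicit Types f g : T -> R.

(** Under a probability this implies integrability and is stable under the algebraic operations, so
    linearity, monotonicity and Fubini all follow from one easily checked predicate. *)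
Definition bmeas f := measurable_fun setT f /\ exists M, forall x, `|f x| <= M.

Lemma bmeas_cst r : bmeas (fun=> r).
Proof. by split; [exact: measurable_cst|exists `|r|]. Qed.

Lemma bmeasD f g : bmeas f -> bmeas g -> bmeas (fun x => f x + g x).
Proof.
move=> [mf [M fM]] [mg [N gN]]; split; first exact: measurable_funD.
by exists (M + N) => x; rewrite (le_trans (ler_normD _ _))// lerD.
Qed.

Lemma bmeasM f g : bmeas f -> bmeas g -> bmeas (fun x => f x * g x).
Proof.
move=> [mf [M fM]] [mg [N gN]]; split; first exact: measurable_funM.
by exists (M * N) => x; rewrite normrM ler_pM.
Qed.

Lemma bmeasZ r f : bmeas f -> bmeas (fun x => r * f x).
Proof. by move=> bf; exact: bmeasM (bmeas_cst r) bf. Qed.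

Lemma bmeasN f : bmeas f -> bmeas (fun x => - f x).
Proof.
move=> bf; rewrite (_ : (fun x => _) = fun x => -1 * f x); first exact: bmeasZ.
by apply/funext => x; rewrite mulN1r.
Qed.

Lemma bmeasB f g : bmeas f -> bmeas g -> bmeas (fun x => f x - g x).
Proof. by move=> bf bg; apply: bmeasD => //; exact: bmeasN. Qed.

Lemma bmeas_norm f : bmeas f -> bmeas (fun x => `|f x|).
Proof.
move=> [mf [M fM]]; split; first exact: measurableT_comp.
by exists M => x; rewrite normr_id.
Qed.

Lemma bmeasX f n : bmeas f -> bmeas (fun x => f x ^+ n).
Proof.
move=> bf; elim: n => [|n ih]; first exact: bmeas_cst.
rewrite (_ : (fun x => _) = fun x => f x * f x ^+ n); first exact: bmeasM.
by apply/funext => x; rewrite exprS.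
Qed.

Lemma bmeas_sum (I : Type) (s : seq I) (Q : pred I) (F : I -> T -> R) :
  (forall i, bmeas (F i)) -> bmeas (fun x => \sum_(i <- s | Q i) F i x).
Proof.
move=> bF; elim: s => [|i s ih].
  by rewrite (_ : (fun x => _) = fun=> 0); [exact: bmeas_cst|
    apply/funext => x; rewrite big_nil].
rewrite (_ : (fun x => _) = fun x =>
    (if Q i then F i x else 0) + \sum_(j <- s | Q j) F j x); last first.
  by apply/funext => x; rewrite big_cons; case: ifP => //; rewrite add0r.
by apply: bmeasD => //; case: (Q i) => //; exact: bmeas_cst.
Qed.

Variable P : probability T R.

Lemma bmeas_integrable f : bmeas f -> P.-integrable setT (EFin \o f).
Proof.
move=> [mf [M fM]]; apply: measurable_bounded_integrable => //.
  by rewrite (le_lt_trans (probability_le1 _ _))// ltry.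
exists M; split; first exact: num_real.
by move=> x Mx y _ /=; rewrite (le_trans (fM _))// ltW.
Qed.

Lemma RintD f g : bmeas f -> bmeas g ->
  \int[P]_x (f x + g x) = \int[P]_x f x + \int[P]_x g x.
Proof. by move=> bf bg; rewrite RintegralD//; exact: bmeas_integrable. Qed.

Lemma RintB f g : bmeas f -> bmeas g ->
  \int[P]_x (f x - g x) = \int[P]_x f x - \int[P]_x g x.
Proof. by move=> bf bg; rewrite RintegralB//; exact: bmeas_integrable. Qed.

Lemma RintZ r f : bmeas f -> \int[P]_x (r * f x) = r * \int[P]_x f x.
Proof. by move=> bf; rewrite RintegralZl//; exact: bmeas_integrable. Qed.

Lemma RintC r : \int[P]_x r = r.
Proof.
rewrite (Rintegral_cst P measurableT).
rewrite -[RHS]mulr1; congr (_ * _).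
by have /(congr1 fine) := probability_setT P.
Qed.

Lemma Rint_sum (I : Type) (s : seq I) (Q : pred I) (F : I -> T -> R) :
  (forall i, bmeas (F i)) ->
  \int[P]_x (\sum_(i <- s | Q i) F i x) = \sum_(i <- s | Q i) \int[P]_x F i x.
Proof.
move=> bF; elim: s => [|i s ih].
  by under eq_Rintegral do rewrite big_nil; rewrite big_nil RintC.
under eq_Rintegral do rewrite big_cons.
rewrite big_cons; case: ifP => // Qi.
by rewrite RintD// ?ih//; exact: bmeas_sum.
Qed.

Lemma Rint_le f g : bmeas f -> bmeas g -> (forall x, f x <= g x) ->
  \int[P]_x f x <= \int[P]_x g x.
Proof. by move=> bf bg fg; apply: le_Rintegral => //; exact: bmeas_integrable. Qed.

Lemma Rint_ae_eq f g : bmeas f -> bmeas g -> {ae P, forall x, f x = g x} ->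
  \int[P]_x f x = \int[P]_x g x.
Proof.
move=> [mf _] [mg _] fg; congr fine; apply: ae_eq_integral => //.
- exact/measurable_EFinP.
- exact/measurable_EFinP.
- by apply: filterS fg => x /= -> _.
Qed.

(** The maximum of f and g dominates f everywhere and equals g almost everywhere. *)
Lemma Rint_ae_le f g : bmeas f -> bmeas g -> {ae P, forall x, f x <= g x} ->
  \int[P]_x f x <= \int[P]_x g x.
Proof.
move=> bf bg fg.
have bm : bmeas (fun x => Num.max (f x) (g x)).
  case: bf bg => mf [M fM] [mg [N gN]]; split; first exact: measurable_maxr.
  exists (Num.max M N) => x; rewrite ler_norml; have := fM x; have := gN x.
  by rewrite !ler_norml !maxEle; do 2 case: ifP => ?; lra.
rewrite -(Rint_ae_eq bm bg); last first.
  by apply: filterS fg => x /= /max_idPr.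
by apply: Rint_le => // x; rewrite le_max lexx.
Qed.

Lemma Rint_norm_le f M : bmeas f -> (forall x, `|f x| <= M) ->
  `|\int[P]_x f x| <= M.
Proof.
move=> bf fM; apply: (le_trans (le_normr_Rintegral measurableT (bmeas_integrable bf))).
by rewrite -[leRHS]RintC; apply: Rint_le => //; [exact: bmeas_norm|exact: bmeas_cst].
Qed.

Lemma Rint_EFin f : bmeas f -> (\int[P]_x (f x)%:E = (\int[P]_x f x)%R%:E)%E.
Proof.
by move=> bf; rewrite fineK//; exact/integrable_fin_num/bmeas_integrable.
Qed.

End bounded_measurable.

Lemma bmeas_comp d1 d2 (T1 : measurableType d1) (T2 : measurableType d2)
    (R : realType) (f : T2 -> R) (g : T1 -> T2) :
  bmeas f -> measurable_fun setT g -> bmeas (fun x => f (g x)).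
Proof.
by move=> [mf [M fM]] mg; split; [exact: measurableT_comp|exists M => x].
Qed.

Section fubini_bounded.
Context d1 d2 (T1 : measurableType d1) (T2 : measurableType d2) (R : realType)
  (P : probability T1 R) (Q : probability T2 R).
Variable f : T1 * T2 -> R.
Hypothesis bf : bmeas f.

Lemma bmeas_pairl x : bmeas (fun y => f (x, y)).
Proof. by apply: bmeas_comp bf _; exact: measurable_pair1. Qed.

Lemma bmeas_pairr y : bmeas (fun x => f (x, y)).
Proof. by apply: bmeas_comp bf _; exact: measurable_pair2. Qed.

Lemma integrable_prod : (P \x Q)%E.-integrable setT (EFin \o f).
Proof. by apply: bmeas_integrable. Qed.

Lemma bmeas_Rint_r : bmeas (fun x => \int[Q]_y f (x, y)).
Proof.
split.
  apply/measurable_EFinP.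
  have := measurable_fubini_F integrable_prod.
  congr (measurable_fun _ _); apply/funext => x /=.
  by rewrite /fubini_F/= -Rint_EFin//; exact: bmeas_pairl.
case: (bf) => _ [M fM]; exists M => x.
by apply: Rint_norm_le => //; exact: bmeas_pairl.
Qed.

Lemma bmeas_Rint_l : bmeas (fun y => \int[P]_x f (x, y)).
Proof.
split.
  apply/measurable_EFinP.
  have := measurable_fubini_G integrable_prod.
  congr (measurable_fun _ _); apply/funext => x /=.
  by rewrite /fubini_G/= -Rint_EFin//; exact: bmeas_pairr.
case: (bf) => _ [M fM]; exists M => x.
by apply: Rint_norm_le => //; exact: bmeas_pairr.
Qed.

Lemma Rint_fubini_prod :
  \int[(P \x Q)%E]_z f z = \int[P]_x \int[Q]_y f (x, y).
Proof.
congr fine; rewrite -(integral12_prod_meas1 integrable_prod).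
by apply: eq_integral => x _; rewrite /fubini_F/= -Rint_EFin//; exact: bmeas_pairl.
Qed.

Lemma Rint_fubini :
  \int[P]_x \int[Q]_y f (x, y) = \int[Q]_y \int[P]_x f (x, y).
Proof.
rewrite -Rint_fubini_prod.
congr fine; rewrite -(integral21_prod_meas1 integrable_prod).
by apply: eq_integral => y _; rewrite /fubini_G/= -Rint_EFin//; exact: bmeas_pairr.
Qed.

End fubini_bounded.

(** * The kernel and the loss *)

Section kernel.
Context {R : realType}.
Local Notation plane := (R * R)%type.
Implicit Types x w v : plane.

Lemma measurable_step_act : measurable_fun setT (@step_act R).
Proof.
rewrite (_ : @step_act R = \1_(`]0, +oo[%classic)).
  exact: measurable_indic.
apply/funext => a; rewrite /step_act indicE mem_setE in_itv/= andbT.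
by case: ifP.
Qed.

Lemma step_act_itv (a : R) : 0 <= step_act a <= 1.
Proof. by rewrite /step_act; case: ifP; rewrite lexx ler01. Qed.

Lemma step_act_ge0 (a : R) : 0 <= step_act a.
Proof. by case/andP: (step_act_itv a). Qed.

Lemma bmeas_act : bmeas (fun z : plane * plane => step_act (dot z.1 z.2)).
Proof.
split.
  apply: measurableT_comp; first exact: measurable_step_act.
  apply: measurable_funD; apply: measurable_funM;
    by repeat (apply: measurableT_comp => //).
by exists 1 => z; have /andP[? ?] := step_act_itv (dot z.1 z.2); rewrite ger0_norm.
Qed.

Lemma bmeas_actl w : bmeas (fun x => step_act (dot x w)).
Proof. by have := bmeas_pairr bmeas_act w. Qed.

Lemma bmeas_actr x : bmeas (fun w => step_act (dot x w)).
Proof. by have := bmeas_pairl bmeas_act x. Qed.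

(** The Gram kernel of the random feature x. For it, [pot] is the mean embedding of nu, [self_pot]
    its squared norm, and [lossE] writes the loss as a squared maximum mean discrepancy. *)
Definition kern w v : R :=
  \int[circle_uniform R]_x (step_act (dot x w) * step_act (dot x v)).

Lemma kernC w v : kern w v = kern v w.
Proof. by apply: eq_Rintegral => x _; rewrite mulrC. Qed.

Lemma kern_itv w v : 0 <= kern w v <= 1.
Proof.
have b : bmeas (fun x => step_act (dot x w) * step_act (dot x v)).
  by apply: bmeasM; exact: bmeas_actl.
apply/andP; split.
  by apply: Rintegral_ge0 => x _; apply: mulr_ge0; exact: step_act_ge0.
rewrite -[leRHS](RintC (circle_uniform R)); apply: Rint_le => //.
  exact: bmeas_cst.
move=> x; have /andP[? ?] := step_act_itv (dot x w).
by have /andP[? ?] := step_act_itv (dot x v); rewrite mulr_ile1.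
Qed.

Variable nu : probability plane R.

Lemma bmeas_target : bmeas (target nu).
Proof. exact: (bmeas_Rint_r nu nu bmeas_act). Qed.

Lemma Rint_target (g : plane -> R) : bmeas g ->
  \int[circle_uniform R]_x (g x * target nu x) =
  \int[nu]_v \int[circle_uniform R]_x (g x * step_act (dot x v)).
Proof.
move=> bg.
have b : bmeas (fun z : plane * plane => g z.1 * step_act (dot z.1 z.2)).
  by apply: bmeasM; [apply: bmeas_comp bg _|exact: bmeas_act].
rewrite -(Rint_fubini (circle_uniform R) nu b)/=.
by apply: eq_Rintegral => x _; rewrite RintZ//; exact: bmeas_actr.
Qed.

Lemma bmeas_kern w : bmeas (kern w).
Proof.
have b : bmeas (fun z : plane * plane =>
    step_act (dot z.1 w) * step_act (dot z.1 z.2)).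
  by apply: bmeasM; [apply: bmeas_comp (bmeas_actl w) _|exact: bmeas_act].
by have := bmeas_Rint_l (circle_uniform R) nu b.
Qed.

Definition pot w : R := \int[nu]_v kern w v.

Lemma potE w :
  pot w = \int[circle_uniform R]_x (step_act (dot x w) * target nu x).
Proof. by rewrite Rint_target//; exact: bmeas_actl. Qed.

Lemma bmeas_pot : bmeas pot.
Proof.
rewrite (_ : pot = fun w =>
    \int[circle_uniform R]_x (target nu x * step_act (dot x w))); last first.
  by apply/funext => w; rewrite potE; under eq_Rintegral do rewrite mulrC.
have b : bmeas (fun z : plane * plane => target nu z.1 * step_act (dot z.1 z.2)).
  by apply: bmeasM; [apply: bmeas_comp bmeas_target _|exact: bmeas_act].
by have := bmeas_Rint_l (circle_uniform R) nu b.
Qed.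

Definition self_pot : R := \int[nu]_w pot w.

Lemma self_potE :
  self_pot = \int[circle_uniform R]_x (target nu x * target nu x).
Proof.
rewrite Rint_target; last exact: bmeas_target.
apply: eq_Rintegral => w _; rewrite potE.
by under eq_Rintegral do rewrite mulrC.
Qed.

Lemma self_pot_ge0 : 0 <= self_pot.
Proof. by rewrite self_potE; apply: Rintegral_ge0 => x _; rewrite -expr2 sqr_ge0. Qed.

Lemma lossE n (w : 'I_n -> plane) : loss nu w =
  (n%:R^-1) ^+ 2 * (\sum_i \sum_j kern (w i) (w j))
  - 2 * n%:R^-1 * (\sum_i pot (w i)) + self_pot.
Proof.
rewrite self_potE /loss.
pose a i x := step_act (dot x (w i)).
have ba i : bmeas (a i) by exact: bmeas_actl.
have bt := bmeas_target.
transitivity (\int[circle_uniform R]_x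
  (((n%:R^-1) ^+ 2 * (\sum_i \sum_j a i x * a j x)
   - 2 * n%:R^-1 * (\sum_i a i x * target nu x)) + target nu x * target nu x)).
  apply: eq_Rintegral => x _; rewrite /network.
  have -> : \sum_i \sum_j a i x * a j x = (\sum_i a i x) ^+ 2.
    by rewrite expr2 mulr_suml; apply: eq_bigr => i _; rewrite mulr_sumr.
  by rewrite -mulr_suml; ring.
have b1 : bmeas (fun x => \sum_i \sum_j a i x * a j x).
  by apply: bmeas_sum => i; apply: bmeas_sum => j; exact: bmeasM.
have b2 : bmeas (fun x => \sum_i a i x * target nu x).
  by apply: bmeas_sum => i; exact: bmeasM.
rewrite RintD; [|by apply: bmeasB; exact: bmeasZ|exact: bmeasM].
rewrite RintB; [|exact: bmeasZ|exact: bmeasZ].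
rewrite !RintZ//; congr (_ * _ - _ * _ + _).
  rewrite Rint_sum => [|i]; last by apply: bmeas_sum => j; exact: bmeasM.
  apply: eq_bigr => i _; rewrite Rint_sum// => j; exact: bmeasM.
rewrite Rint_sum => [|i]; last exact: bmeasM.
by apply: eq_bigr => i _; rewrite potE.
Qed.

Lemma network_itv n (w : 'I_n -> plane) x : 0 <= network w x <= 1.
Proof.
case: n w => [|n] w; first by rewrite /network invr0 mul0r lexx ler01.
rewrite /network mulr_ge0 ?invr_ge0//; last first.
  by apply: sumr_ge0 => i _; case/andP: (step_act_itv (dot x (w i))).
rewrite ler_pdivrMl ?ltr0n// mulr1 (@le_trans _ _ (\sum_(i < n.+1) 1))//.
  by apply: ler_sum => i _; case/andP: (step_act_itv (dot x (w i))).
by rewrite sumr_const card_ord.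
Qed.

Lemma target_itv x : 0 <= target nu x <= 1.
Proof.
apply/andP; split.
  by apply: Rintegral_ge0 => w _; case/andP: (step_act_itv (dot x w)).
rewrite -[leRHS](RintC nu); apply: Rint_le; [exact: bmeas_actr|exact: bmeas_cst|].
by move=> w; case/andP: (step_act_itv (dot x w)).
Qed.

Lemma loss_itv n (w : 'I_n -> plane) : 0 <= loss nu w <= 1.
Proof.
have b : bmeas (network w).
  by apply: bmeasZ; apply: bmeas_sum => i; exact: bmeas_actl.
rewrite Rintegral_ge0/=; last by move=> x _; rewrite sqr_ge0.
rewrite -[leRHS](RintC (circle_uniform R)); apply: Rint_le.
- by apply: bmeasX; apply: bmeasB => //; exact: bmeas_target.
- exact: bmeas_cst.
- move=> x; have := network_itv w x; have := target_itv x => /andP[? ?] /andP[? ?].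
  by rewrite -real_normK ?num_real// exprn_ile1// ler_norml; lra.
Qed.

End kernel.

(** * The kernel between two points of the half circle *)

Section kernel_half_circle.
Context {R : realType}.
Local Notation plane := (R * R)%type.

(** The range [-pi, 2 pi] is that of the differences of an angle in [0, 2 pi] and one in [0, pi]. *)
Lemma cos_gt0E (d : R) : - pi <= d <= 2 * pi ->
  (0 < cos d) = (- (pi / 2) < d < pi / 2) || (3 * pi / 2 < d).
Proof.
have pi0 := pi_gt0 R => /andP[dl du].
have [d1|d1] := ltrP d (pi / 2); last first.
  rewrite andbF/=; have [d2|d2] := ltrP (3 * pi / 2) d.
    rewrite -[d](subrK (pi *+ 2)) cosD2pi cos_gt0_pihalf// [pi *+ 2]mulr2n.
    by apply/andP; split; lra.
  apply/negbTE; rewrite -leNgt -[d](subrK pi) cosDpi oppr_le0.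
  by apply: cos_ge0_pihalf; apply/andP; split; lra.
have [d2|d2] := ltrP (- (pi / 2)) d; first by rewrite cos_gt0_pihalf// d2.
have -> : (3 * pi / 2 < d) = false by apply/negbTE; rewrite -leNgt; lra.
apply/negbTE; rewrite -leNgt -cosN -[- d](subrK pi) cosDpi oppr_le0.
by apply: cos_ge0_pihalf; apply/andP; split; lra.
Qed.

Lemma dot_circle_point (s t : R) :
  dot (circle_point s) (circle_point t) = cos (s - t).
Proof. by rewrite cosB. Qed.

Lemma circle_uniform_set (S : set R) (U : set plane) r : measurable S -> measurable U ->
  (forall t, 0 <= t <= 2 * pi -> U (circle_point t) <-> S t) ->
  lebesgue_measure (S `&` `[0, 2 * pi]) = r%:E ->
  \int[circle_uniform R]_x \1_U x = r / (2 * pi).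
Proof.
move=> mS mU US Sr; rewrite /Rintegral.
rewrite ge0_integral_distribution//=; [|exact/measurable_EFinP/measurable_indic].
rewrite integral_uniform//=; last first.
  apply/measurable_EFinP; apply: measurableT_comp; first exact: measurable_indic.
  exact: measurable_circle_point.
rewrite subr0 -(mulr_natl pi 2).
rewrite (_ : (\int[_]_(_ in _) _)%E = r%:E) /=; first by rewrite mulrC.
rewrite -Sr -integral_indic//; apply: eq_integral => t.
rewrite inE/= in_itv/= => t2; rewrite !indicE.
rewrite (_ : (circle_point t \in U) = (t \in S))//; apply/idP/idP.
  by rewrite !inE => /(US t t2).
by rewrite !inE => /(US t t2).
Qed.

Lemma kern_circle_point_le (y z : R) : 0 <= y -> y <= z -> z <= pi ->
  kern (circle_point y) (circle_point z) = (pi - (z - y)) / (2 * pi).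
Proof.
move=> y0 yz zpi; have pi0 := pi_gt0 R.
pose f x := step_act (dot x (circle_point y)) * step_act (dot x (circle_point z)).
have [mf _] : bmeas f by apply: bmeasM; exact: bmeas_actl.
pose U : set plane :=
  [set x | (0 < dot x (circle_point y)) && (0 < dot x (circle_point z))].
have fE : f = \1_U.
  apply/funext => x; rewrite /f /step_act indicE.
  rewrite (_ : (x \in U) = (0 < dot x (circle_point y)) && (0 < dot x (circle_point z))).
    by case: ifP => _; case: ifP => _; rewrite ?mulr0 ?mulr1.
  by apply/idP/idP; rewrite inE.
have mU : measurable U.
  have -> : U = f @^-1` `]0, +oo[%classic.
    apply/seteqP; split => x /=; rewrite in_itv/= andbT fE indicE.
      by move=> Ux; rewrite mem_set//.
    by case: (boolP (x \in U)); rewrite ?inE ?ltxx.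
  by rewrite -[X in measurable X]setTI; apply: mf => //; exact: measurable_itv.
rewrite /kern -/(f _) -[X in \int[_]_x X x]/f fE.
have UE t : 0 <= t <= 2 * pi -> U (circle_point t) <->
    ((- (pi / 2) < t - y < pi / 2) || (3 * pi / 2 < t - y)) /\
    ((- (pi / 2) < t - z < pi / 2) || (3 * pi / 2 < t - z)).
  move=> /andP[t0 t2]; rewrite /U/= !dot_circle_point !cos_gt0E; try by apply/andP; split; lra.
  by split => [/andP[]|[-> ->]].
(* The two half planes meet in the arc ]z - pi/2, y + pi/2[. It is one interval of [0, 2 pi] when z
   >= pi/2; otherwise it passes through the angle 0 and splits in two. *)
have [z2|z2] := lerP (pi / 2) z.
  apply: (@circle_uniform_set (`]z - pi / 2, y + pi / 2[%classic)) => //.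
    move=> t /[dup] t2 /UE ->; rewrite /= in_itv/=.
    move: t2 => /andP[? ?]; split.
      by move=> [/orP[/andP[? ?]|?] /orP[/andP[? ?]|?]]; apply/andP; split; lra.
    by move=> /andP[? ?]; split; apply/orP; left; apply/andP; split; lra.
  rewrite setIidl; last first.
    move=> t/=; rewrite !in_itv/= => /andP[? ?]; apply/andP; split; lra.
  rewrite lebesgue_measure_itv/= lte_fin; case: ifPn => [_|].
    by rewrite -EFinD; congr EFin; lra.
  by rewrite -leNgt => ?; congr EFin; lra.
apply: (@circle_uniform_set
    (`[0, y + pi / 2[%classic `|` `]z + 3 * pi / 2, 2 * pi]%classic)) => //.
- exact: measurableU.
- move=> t /[dup] t2 /UE ->; rewrite /= !in_itv/=.
  move: t2 => /andP[? ?]; split.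
    move=> [/orP[/andP[? ?]|?] /orP[/andP[? ?]|?]];
    by [left; apply/andP; split; lra|right; apply/andP; split; lra|lra].
  move=> [/andP[? ?]|/andP[? ?]]; split; apply/orP.
  + by left; apply/andP; split; lra.
  + by left; apply/andP; split; lra.
  + by right; lra.
  + by right; lra.
- rewrite setIidl; last first.
    by move=> t/=; rewrite !in_itv/= => -[|] /andP[? ?]; apply/andP; split; lra.
  rewrite measureU//; last first.
    apply/seteqP; split => // t/=; rewrite !in_itv/= => -[/andP[? ?] /andP[? ?]]; lra.
  pose I1 : set R := `[0, y + pi / 2[%classic.
  pose I2 : set R := `]z + 3 * pi / 2, 2 * pi]%classic.
  transitivity (lebesgue_measure I1 + lebesgue_measure I2)%E; first by [].
  rewrite !lebesgue_measure_itv/= !lte_fin ifT; last lra.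
  by rewrite ifT; [rewrite -!EFinD; congr EFin; lra|lra].
Qed.

Lemma kern_circle_point (y z : R) : 0 <= y <= pi -> 0 <= z <= pi ->
  kern (circle_point y) (circle_point z) = 1 / 2 - `|y - z| / (2 * pi).
Proof.
move=> /andP[y0 y1] /andP[z0 z1].
have pi0 : pi != 0 :> R by rewrite gt_eqF// pi_gt0.
have [yz|/ltW zy] := lerP y z.
  rewrite kern_circle_point_le//.
  by move: pi pi0 {y1 z1} => p p0; field.
rewrite kernC kern_circle_point_le//.
by move: pi pi0 {y1 z1} => p p0; field.
Qed.

End kernel_half_circle.

(** * The support of a measure on the plane *)

Section rational_boxes.
Context {R : realType}.
Local Notation plane := (R * R)%type.

(** A countable base of the plane: it makes open sets measurable for the product sigma-algebra, and
    covers the complement of the support by countably many null sets. *)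
Definition rat_box (q : (rat * rat) * (rat * rat)) : set plane :=
  `]ratr q.1.1, ratr q.1.2[%classic `*` `]ratr q.2.1, ratr q.2.2[%classic.

Lemma measurable_rat_box q : measurable (rat_box q).
Proof. by apply: measurableX; exact: measurable_itv. Qed.

Lemma open_rat_box (U : set plane) w : open U -> U w ->
  exists q, rat_box q w /\ rat_box q `<=` U.
Proof.
move=> oU Uw; have : nbhs w U by exact: open_nbhs_nbhs.
case: w Uw => w1 w2 Uw [[A B]/= [/nbhs_ballP[e/= e0 eA] /nbhs_ballP[e'/= e'0 eB]] ABU].
have box1 (x r : R) : 0 < r -> exists q : rat * rat,
    (`]ratr q.1, ratr q.2[%classic : set R) x /\
    `]ratr q.1, ratr q.2[%classic `<=` ball x r.
  move=> r0.
  have [|q1] := @rat_in_itvoo R (x - r) x; first by rewrite ltrBlDr ltrDl.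
  have [|q2] := @rat_in_itvoo R x (x + r); first by rewrite ltrDl.
  rewrite !in_itv/= => /andP[? ?] /andP[? ?]; exists (q1, q2); split => /=.
    by rewrite in_itv/=; apply/andP.
  move=> y/=; rewrite in_itv/= => /andP[? ?]; rewrite /ball/= ltr_norml.
  by apply/andP; split; lra.
have [q1 [q1w q1A]] := box1 w1 e e0.
have [q2 [q2w q2A]] := box1 w2 e' e'0.
exists (q1, q2); split; first by split.
by move=> [y1 y2] [/= /q1A/eA ? /q2A/eB ?]; exact: ABU.
Qed.

Lemma open_measurable_plane (U : set plane) : open U -> measurable U.
Proof.
move=> oU; pose F n : set plane :=
  if unpickle n is Some q then if `[< rat_box q `<=` U >] then rat_box q else set0
  else set0.
rewrite (_ : U = \bigcup_n F n).
  apply: bigcupT_measurable => n; rewrite /F; case: unpickle => // q.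
  by case: ifP => _ //; exact: measurable_rat_box.
apply/seteqP; split => w.
  move=> /(open_rat_box oU)[q [qw qU]]; exists (pickle q); first exact: I.
  by rewrite /F pickleK; move: qU => /asboolP ->.
move=> [n _]; rewrite /F; case: unpickle => // q.
by case: ifPn => // /asboolP qU /qU.
Qed.

Lemma ae_measure_support (nu : probability plane R) :
  {ae nu, forall w, measure_support nu w}.
Proof.
pose F n : set plane :=
  if unpickle n is Some q then if nu (rat_box q) == 0%E then rat_box q else set0
  else set0.
have F0 n : nu.-negligible (F n).
  rewrite /F; case: unpickle => [q|]; last exact: negligible_set0.
  case: ifPn => [/eqP q0|_]; last exact: negligible_set0.
  by apply/negligibleP => //; exact: measurable_rat_box.
apply: negligibleS (negligible_bigcup F0) => w /= /existsNP[U /not_implyP[oU]].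
move=> /not_implyP[Uw] /negP; rewrite -leNgt => U0.
have [q [qw qU]] := open_rat_box oU Uw.
have q0 : nu (rat_box q) == 0%E.
  rewrite eq_le measure_ge0 andbT; apply: le_trans U0; apply: le_measure => //.
    by rewrite inE; exact: measurable_rat_box.
  by rewrite inE; exact: open_measurable_plane.
by exists (pickle q); [exact: I|rewrite /F pickleK q0].
Qed.

End rational_boxes.

(** * The energy of a configuration of angles *)

Section energy.
Context {R : realType}.
Local Notation plane := (R * R)%type.

Definition fold_point (t : R) : plane := (cos t, `|sin t|).

Lemma fold_pointE t : fold_point t = circle_point (fold t).
Proof. by rewrite /circle_point cos_fold sin_fold. Qed.

Lemma circle_fold_point t : circle (fold_point t).
Proof. by rewrite /circle/= real_normK ?num_real// cos2Dsin2. Qed.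

Lemma measurable_fold_point : measurable_fun setT fold_point.
Proof.
apply: measurable_fun_pair; apply: continuous_measurable_fun.
  exact: continuous_cos.
by move=> x; apply: continuous_comp; [exact: continuous_sin|exact: norm_continuous].
Qed.

(** Total, with values in [0, pi] on the whole plane thanks to the default value of [acos]; it is
    the genuine angle on the half circle, hence nu-almost everywhere once nu is supported there. *)
Definition angle (w : plane) : R := acos w.1.

Lemma acos_itv (a : R) : 0 <= acos a <= pi.
Proof.
rewrite unlock; case: xgetP => [y _ []//|_]; by rewrite lexx pi_ge0.
Qed.

Lemma measurable_angle : measurable_fun setT angle.
Proof. by apply: measurableT_comp; [exact: measurable_acos|exact: measurable_fst]. Qed.

Lemma angle_itv w : 0 <= angle w <= pi. Proof. exact: acos_itv. Qed.

Lemma upper_half_circleE w : upper_half_circle w -> w = circle_point (angle w).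
Proof.
move=> [cw w0]; have w1 : -1 <= w.1 <= 1.
  have : w.1 ^+ 2 <= 1 by rewrite -cw lerDl sqr_ge0.
  by move=> ?; apply/andP; split; nra.
rewrite /angle /circle_point acosK ?in_itv// sin_acos//.
by rewrite -cw addrAC subrr add0r sqrtr_sqr ger0_norm//; case: (w).
Qed.

HB.instance Definition _ :=
  isMeasurableFun.Build _ _ _ _ angle measurable_angle.

Variable nu : probability plane R.

Lemma bmeas_dist_angle (y : R) : bmeas (fun w => `|y - angle w|).
Proof.
apply: bmeas_norm; apply: bmeasB; first exact: bmeas_cst.
split; first exact: measurable_angle.
by exists pi => w; have /andP[? ?] := angle_itv w; rewrite ger0_norm.
Qed.

Definition mean_dist (y : R) : R := \int[nu]_w `|y - angle w|.

Lemma mean_dist_convex t y z : 0 <= t <= 1 ->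
  mean_dist ((1 - t) * y + t * z) <= (1 - t) * mean_dist y + t * mean_dist z.
Proof.
move=> /andP[t0 t1]; rewrite /mean_dist -!RintZ; try exact: bmeas_dist_angle.
rewrite -RintD; try by apply: bmeasZ; exact: bmeas_dist_angle.
apply: Rint_le; first exact: bmeas_dist_angle.
  by apply: bmeasD; apply: bmeasZ; exact: bmeas_dist_angle.
move=> w.
rewrite (_ : _ - _ = (1 - t) * (y - angle w) + t * (z - angle w)); last by ring.
by rewrite (le_trans (ler_normD _ _))// !normrM (ger0_norm t0) ger0_norm ?subr_ge0.
Qed.

Lemma mean_dist_lipschitz y z : `|mean_dist y - mean_dist z| <= `|y - z|.
Proof.
rewrite /mean_dist -RintB; try exact: bmeas_dist_angle.
apply: Rint_norm_le; first by apply: bmeasB; exact: bmeas_dist_angle.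
by move=> w; rewrite (le_trans (ler_dist_dist _ _))// opprB addrA subrK.
Qed.

(** The derivative is the mean of [sg], the sign of y - a with a the random angle. The difference
    quotient equals this sign as soon as |h| < |y - a| and differs from it by at most 2 otherwise,
    so the error is at most 2 nu(|y - a| <= 1/(n+1)), which tends to twice the mass of the atom at
    y, that is 0. *)
Lemma mean_dist_derivable y : @pmf _ _ _ nu angle y = 0 -> derivable mean_dist y 1.
Proof.
move=> y0.
pose sg w : R := if angle w < y then 1 else -1.
have bsg : bmeas sg.
  split.
    apply: measurable_fun_ifT; [|exact: measurable_cst|exact: measurable_cst].
    by apply: measurable_fun_ltr; [exact: measurable_angle|exact: measurable_cst].
  by exists 1 => w; rewrite /sg; case: ifP; rewrite ?normrN normr1.
pose B n : set plane := [set w | `|y - angle w| <= n.+1%:R^-1].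
have mB n : measurable (B n).
  have [mf _] := bmeas_dist_angle y.
  rewrite (_ : B n = (fun w => `|y - angle w|) @^-1` `]-oo, n.+1%:R^-1]%classic).
    by rewrite -[X in measurable X]setTI; apply: mf => //; exact: measurable_itv.
  by apply/seteqP; split => w/=; rewrite in_itv.
have Bcap : \bigcap_n B n = angle @^-1` [set y].
  apply/seteqP; split => w /=; last first.
    by move=> wy n _; rewrite /B/= wy subrr normr0 invr_ge0.
  move=> Bw; apply/eqP; rewrite eq_sym -subr_eq0 -normr_le0; apply/ler_addgt0Pl => e e0.
  rewrite addr0; have [n ne] : exists n, n.+1%:R^-1 < e.
    by have [n] := ltr_add_invr e0; rewrite add0r; exists n.
  by apply: le_trans (Bw n I) (ltW ne).
have cB : (nu \o B) n @[n --> \oo] --> 0%E.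
  have -> : 0%E = nu (\bigcap_n B n).
    rewrite Bcap; move: y0; rewrite /pmf => /eqP.
    by rewrite fine_eq0 ?fin_num_measure// => /eqP ->.
  apply: nonincreasing_cvg_mu => //.
  - by rewrite (le_lt_trans (probability_le1 _ _))// ltry.
  - exact: bigcapT_measurable.
  - move=> m n mn; apply/subsetPset => w; rewrite /B/= => /le_trans; apply.
    by rewrite lef_pV2 ?posrE// ler_nat.
apply/cvg_ex; exists (\int[nu]_w sg w) => /=.
apply/cvgrPdist_le => /= e e0.
have [n ne] : exists n, 2 * fine (nu (B n)) <= e.
  have /fine_cvg/cvgrPdist_le/(_ (e / 2)) := cB.
  rewrite divr_gt0// => /(_ isT)[n _ /(_ n)]/=; rewrite leqnn => /(_ isT).
  rewrite sub0r normrN ger0_norm ?fine_ge0// => ne; exists n; lra.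
near=> h.
have h0 : h != 0 by near: h; exact: nbhs_dnbhs_neq.
have hn : `|h| <= n.+1%:R^-1.
  by near: h; apply: dnbhs0_le.
rewrite [h *: 1]mulr1 -[_ *: _]/(h^-1 * _).
have bq : bmeas (fun w => h^-1 * (`|h + y - angle w| - `|y - angle w|)).
  by apply: bmeasZ; apply: bmeasB; exact: bmeas_dist_angle.
rewrite /mean_dist -RintB; try exact: bmeas_dist_angle.
rewrite -RintZ; last by apply: bmeasB; exact: bmeas_dist_angle.
rewrite -RintB//.
have b1 : bmeas (fun w => 2 * \1_(B n) w : R).
  apply: bmeasZ; split; first exact: measurable_indic.
  by exists 1 => w; rewrite indicE; case: (_ \in _); rewrite ?normr1 ?normr0.
apply: le_trans (le_normr_Rintegral measurableT (bmeas_integrable nu (bmeasB bsg bq))) _.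
apply: (@le_trans _ _ (\int[nu]_w (2 * \1_(B n) w))).
  apply: Rint_le => //; first by apply: bmeas_norm; exact: bmeasB.
  move=> w; rewrite indicE; have [|/negP nB] := boolP (w \in B n).
    rewrite mulr1 => _.
    have : `|h^-1 * (`|h + y - angle w| - `|y - angle w|)| <= 1.
      rewrite normrM normfV ler_pdivrMl ?normr_gt0// mulr1.
      by rewrite (le_trans (ler_dist_dist _ _))// opprB addrA subrK addrK.
    rewrite /sg; case: ifP => _; rewrite !ler_norml; lra.
  rewrite mulr0 normr_le0 subr_eq0; apply/eqP.
  have : n.+1%:R^-1 < `|y - angle w|.
    by rewrite ltNge; apply/negP => ?; apply: nB; rewrite inE.
  move=> /(le_lt_trans hn); rewrite /sg; case: ifPn => [wy|].
    rewrite (gtr0_norm (_ : 0 < y - angle w)) ?subr_gt0// ltr_norml => /andP[h1 h2].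
    rewrite gtr0_norm; last lra.
    rewrite (_ : _ - (y - _) = h); last by ring.
    by rewrite mulVf.
  rewrite -leNgt => wy.
  rewrite (ler0_norm (_ : y - angle w <= 0)) ?subr_le0// ltr_norml => /andP[h1 h2].
  rewrite ler0_norm; last lra.
  rewrite (_ : - _ - - _ = - h); last by ring.
  by rewrite mulrN mulVf.
rewrite RintZ; last first.
  split; first exact: measurable_indic.
  by exists 1 => w; rewrite indicE; case: (_ \in _); rewrite ?normr1 ?normr0.
by rewrite /Rintegral integral_indic// setIT.
Unshelve. all: by end_near. Qed.

End energy.

Section energy.
Context {R : realType}.
Local Notation plane := (R * R)%type.
Variable nu : probability plane R.

Definition energy n (y : 'I_n -> R) : R :=
  self_pot nu - 1 / 2 + (pi * n%:R)^-1 * (\sum_i mean_dist nu (y i))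
  - (2 * pi * n%:R ^+ 2)^-1 * (\sum_i \sum_j `|y i - y j|).

Lemma energy_perm n (y : 'I_n -> R) (s : {perm 'I_n}) :
  energy (fun i => y (s i)) = energy y.
Proof.
rewrite /energy; congr (_ + _ * _ - _ * _).
  by rewrite [RHS](reindex_inj (@perm_inj _ s)).
rewrite [RHS](reindex_inj (@perm_inj _ s)); apply: eq_bigr => i _.
by rewrite [RHS](reindex_inj (@perm_inj _ s)).
Qed.

(** The attraction and the repulsion each contribute 1 / (pi n) times the distance, and 2 / pi <= 1.
    This is the source of the bound 1/n on the partial derivatives. *)
Lemma energy_lipschitz n (y z : 'I_n -> R) : (0 < n)%N ->
  `|energy y - energy z| <= n%:R^-1 * \sum_i `|y i - z i|.
Proof.
move=> n0; have nR0 : 0 < n%:R :> R by rewrite ltr0n.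
have pi0 := pi_gt0 R; have hpi2 := pi_ge2 R.
set D := \sum_i _.
have D0 : 0 <= D by apply: sumr_ge0.
have h1 : `|\sum_i mean_dist nu (y i) - \sum_i mean_dist nu (z i)| <= D.
  rewrite -sumrB (le_trans (ler_norm_sum _ _ _))//.
  by apply: ler_sum => i _; exact: mean_dist_lipschitz.
have h2 : `|\sum_i \sum_j `|y i - y j| - \sum_i \sum_j `|z i - z j| | <= 2 * n%:R * D.
  rewrite -sumrB (le_trans (ler_norm_sum _ _ _))//.
  apply: (@le_trans _ _ (\sum_(i < n) \sum_(j < n) (`|y i - z i| + `|y j - z j|))).
    apply: ler_sum => i _; rewrite -sumrB (le_trans (ler_norm_sum _ _ _))//.
    apply: ler_sum => j _; rewrite (le_trans (ler_dist_dist _ _))//.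
    rewrite (_ : _ - _ = (y i - z i) - (y j - z j)); last by ring.
    by rewrite ler_normB.
  under eq_bigr do rewrite big_split/= sumr_const card_ord.
  rewrite big_split/= sumr_const card_ord sumrMnl -/D.
  by rewrite -[D *+ n]mulr_natl; lra.
rewrite /energy.
set a := \sum_i mean_dist _ _ in h1 *; set b := \sum_i mean_dist _ _ in h1 *.
set c := \sum_i \sum_j _ in h2 *; set d := \sum_i \sum_j _ in h2 *.
rewrite (_ : _ - _ = (pi * n%:R)^-1 * (a - b) - (2 * pi * n%:R ^+ 2)^-1 * (c - d)); last by ring.
rewrite (le_trans (ler_normB _ _))// !normrM.
rewrite [X in X * _ + _]ger0_norm ?invr_ge0 ?mulr_ge0 ?(ltW pi0)// ?(ltW nR0)//.
rewrite [X in _ + X * _]ger0_norm; last first.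
  by rewrite invr_ge0 !mulr_ge0// ltW.
apply: (@le_trans _ _ ((pi * n%:R)^-1 * D + (2 * pi * n%:R ^+ 2)^-1 * (2 * n%:R * D))).
  by apply: lerD; apply: ler_wpM2l => //; rewrite invr_ge0 ?mulr_ge0// ltW.
have -> : (pi * n%:R)^-1 * D + (2 * pi * n%:R ^+ 2)^-1 * (2 * n%:R * D) =
    (2 / pi) * (n%:R^-1 * D).
  move: nR0 pi0 {hpi2}; move: (pi : R) (n%:R : R) => p m m0 p0.
  by field; rewrite !gt_eqF.
rewrite ler_piMl// ?ler_pdivrMr ?mul1r//.
by rewrite mulr_ge0// invr_ge0 ltW.
Qed.

(** If a - b and c - d do not have opposite signs, the absolute value is linear between them. It
    makes the concave repulsion affine along order-preserving segments. *)
Lemma dist_convexE (t a b c d : R) : 0 <= t <= 1 -> 0 <= (a - b) * (c - d) ->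
  `|((1 - t) * a + t * c) - ((1 - t) * b + t * d)| =
  (1 - t) * `|a - b| + t * `|c - d|.
Proof.
move=> /andP[t0 t1] abcd.
rewrite (_ : _ - _ = (1 - t) * (a - b) + t * (c - d)); last by ring.
have t1' : 0 <= 1 - t by rewrite subr_ge0.
move: (a - b) (c - d) abcd => x y xy {a b c d}.
have [x0|] := boolP (0 <= x); have [y0|] := boolP (0 <= y).
- by rewrite !ger0_norm// addr_ge0// mulr_ge0.
- rewrite -ltNge => y0; have -> : x = 0.
    by apply/eqP; apply: contraTT xy => xn0; rewrite -ltNge nmulr_llt0// lt_neqAle eq_sym xn0.
  by rewrite normr0 !mulr0 !add0r normrM ger0_norm.
- rewrite -ltNge => x0; have -> : y = 0.
    by apply/eqP; apply: contraTT xy => yn0; rewrite -ltNge nmulr_rlt0// lt_neqAle eq_sym yn0.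
  by rewrite normr0 !mulr0 !addr0 normrM ger0_norm.
- rewrite -!ltNge => y0 x0; rewrite (ltr0_norm x0) (ltr0_norm y0).
  rewrite ler0_norm; first by ring.
  by rewrite -oppr_ge0 opprD -!mulrN addr_ge0// mulr_ge0// oppr_ge0 ltW.
Qed.

Lemma energy_convex n (y z : 'I_n -> R) t : (0 < n)%N -> 0 <= t <= 1 ->
  (forall i j, 0 <= (y i - y j) * (z i - z j)) ->
  energy (fun i => (1 - t) * y i + t * z i) <=
  (1 - t) * energy y + t * energy z.
Proof.
move=> n0 t01 yz; have nR0 : 0 < n%:R :> R by rewrite ltr0n.
have pi0 := pi_gt0 R.
rewrite {1}/energy.
under [X in _ - _ * X]eq_bigr do (under eq_bigr do rewrite dist_convexE//).
have -> : \sum_(i < n) \sum_(j < n) ((1 - t) * `|y i - y j| + t * `|z i - z j|) =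
   (1 - t) * (\sum_(i < n) \sum_(j < n) `|y i - y j|)
   + t * (\sum_(i < n) \sum_(j < n) `|z i - z j|).
  rewrite !mulr_sumr -big_split/=; apply: eq_bigr => i _.
  by rewrite !mulr_sumr -big_split.
have : \sum_i mean_dist nu ((1 - t) * y i + t * z i) <=
   (1 - t) * (\sum_i mean_dist nu (y i)) + t * (\sum_i mean_dist nu (z i)).
  rewrite !mulr_sumr -big_split/=; apply: ler_sum => i _.
  exact: mean_dist_convex.
rewrite /energy.
have : 0 <= (pi * n%:R : R)^-1 by rewrite invr_ge0 mulr_ge0// ltW.
move: (\sum_i _) (\sum_i _) (\sum_i _) (\sum_i \sum_j _) (\sum_i \sum_j _).
move: (_^-1) (_^-1) => u v A B C D E u0 ABC.
have := ler_wpM2l u0 ABC.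
lra.
Qed.

Hypothesis hnu : measure_support nu `<=` @upper_half_circle R.

Lemma ae_upper_half_circle : {ae nu, forall w, upper_half_circle w}.
Proof. by apply: filterS (ae_measure_support nu) => w /hnu. Qed.

Lemma pot_circle_point (y : R) : 0 <= y <= pi ->
  pot nu (circle_point y) = 1 / 2 - mean_dist nu y / (2 * pi).
Proof.
move=> y0; have b := bmeas_dist_angle y.
transitivity (\int[nu]_w (1 / 2 - (2 * pi)^-1 * `|y - angle w|)).
  apply: Rint_ae_eq; first exact: bmeas_kern.
    by apply: bmeasB; [exact: bmeas_cst|exact: bmeasZ].
  apply: filterS ae_upper_half_circle => w /upper_half_circleE {1}->.
  by rewrite kern_circle_point// ?angle_itv// [_^-1 * _]mulrC.
rewrite RintB; [|exact: bmeas_cst|exact: bmeasZ].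
by rewrite RintC RintZ// [_^-1 * _]mulrC.
Qed.

Lemma loss_fold n (t : 'I_n -> R) : (0 < n)%N ->
  loss nu (fun i => fold_point (t i)) = energy (fun i => fold (t i)).
Proof.
move=> n0; have nR0 : n%:R != 0 :> R by rewrite pnatr_eq0 -lt0n.
rewrite lossE /energy.
under eq_bigr do under eq_bigr do
  rewrite !fold_pointE kern_circle_point ?fold_itv//.
under [X in _ - _ * X + _]eq_bigr do rewrite fold_pointE pot_circle_point ?fold_itv//.
under eq_bigr do rewrite big_split/= sumr_const card_ord sumrN -mulr_suml.
rewrite !big_split/= !sumr_const !card_ord !sumrN -!mulr_suml.
rewrite -[1 / 2 *+ n *+ n]mulr_natr -[1 / 2 *+ n]mulr_natr.
have := lt0r_neq0 (pi_gt0 R).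
set S := \sum_(i < n) \sum_(j < n) `|fold (t i) - fold (t j)|.
set M := \sum_(i < n) mean_dist nu (fold (t i)).
move: S M (self_pot nu) nR0.
move: (pi : R) (n%:R : R) => p m S M c m0 p0; field.
by rewrite m0 p0.
Qed.

Lemma objectiveE n (theta : 'rV[R]_n) : (0 < n)%N ->
  objective nu fold_point theta = energy (fun i => fold (theta ord0 i)).
Proof. exact: loss_fold. Qed.

Lemma energy_itv n (y : 'I_n -> R) : (0 < n)%N -> (forall i, 0 <= y i <= pi) ->
  0 <= energy y <= 1.
Proof.
move=> n0 y0; rewrite (_ : y = fun i => fold (y i)).
  by rewrite -loss_fold// loss_itv.
by apply/funext => i; rewrite fold_id.
Qed.

End energy.

(** * Herding: configurations of energy O(1/n) *)

Section herding.
Context {R : realType}.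
Local Notation plane := (R * R)%type.
Variable nu : probability plane R.
Hypothesis hnu : measure_support nu `<=` @upper_half_circle R.

(** n^2 times the loss of the first n points; in this scaling an increment of constant size per
    point is what yields the rate 1/n. *)
Let sq_loss n (w : nat -> plane) : R :=
  (\sum_(i < n) \sum_(j < n) kern (w i) (w j))
  - 2 * n%:R * (\sum_(i < n) pot nu (w i)) + n%:R ^+ 2 * self_pot nu.

(* Averaged over q distributed as nu, the cross terms of the increment of
   [sq_loss] cancel, so that some q increases it by at most a constant. *)
Lemma herding_step n (w : nat -> plane) : exists2 q, upper_half_circle q &
  2 * (\sum_(i < n) kern (w i) q) - 2 * (\sum_(i < n) pot nu (w i))
  - 2 * n.+1%:R * pot nu q + (2 * n%:R + 1) * self_pot nu <= 1.
Proof.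
pose g q := 2 * (\sum_(i < n) kern (w i) q) - 2 * (\sum_(i < n) pot nu (w i))
  - 2 * n.+1%:R * pot nu q + (2 * n%:R + 1) * self_pot nu.
have bk : bmeas (fun q => \sum_(i < n) kern (w i) q).
  by apply: bmeas_sum => i; exact: bmeas_kern.
have bp := bmeas_pot nu.
have b1 : bmeas (fun q => 2 * (\sum_(i < n) kern (w i) q) - 2 * (\sum_(i < n) pot nu (w i))).
  by apply: bmeasB; [exact: bmeasZ|exact: bmeas_cst].
have b2 : bmeas (fun q => 2 * n.+1%:R * pot nu q) by exact: bmeasZ.
have bg : bmeas g.
  by apply: bmeasD; [exact: bmeasB|exact: bmeas_cst].
have gint : \int[nu]_q g q = - self_pot nu.
  rewrite /g RintD; [|exact: bmeasB|exact: bmeas_cst].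
  rewrite RintB// RintB; [|exact: bmeasZ|exact: bmeas_cst].
  rewrite !RintC !RintZ// Rint_sum; last by move=> i; exact: bmeas_kern.
  by rewrite -/(self_pot nu) -natr1; ring.
apply: contrapT => nex.
(* The mean of g is at most 0; asking only for a value at most 1 leaves room for a contradiction
   although integration keeps a mere weak inequality. *)
have : 1 <= \int[nu]_q g q.
  rewrite -[leLHS](RintC nu); apply: Rint_ae_le => //; first exact: bmeas_cst.
  apply: filterS (ae_upper_half_circle hnu) => q uq.
  by apply/ltW; rewrite ltNge; apply/negP => gq; apply: nex; exists q.
by rewrite gint; have := self_pot_ge0 nu; lra.
Qed.

(** Each greedy point costs at most 2: at most 1 from [herding_step], and at most 1 from the new
    diagonal term [kern q q]. *)
Lemma herding n : exists2 w : nat -> plane,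
  forall i, upper_half_circle (w i) & sq_loss n w <= 2 * n%:R.
Proof.
elim: n => [|n [w uw IH]].
  exists (fun=> circle_point 0).
    by move=> i; split; rewrite /circle/= ?cos2Dsin2// sin0.
  by rewrite /sq_loss !big_ord0 expr0n/= !mulr0 mul0r subr0 addr0.
have [q uq gq] := herding_step n w.
exists (fun i => if i == n then q else w i).
  by move=> i; case: ifP.
have wn (i : 'I_n) : (widen_ord (leqnSn n) i == n :> nat) = false.
  by apply/negbTE; rewrite neq_ltn/= ltn_ord.
rewrite /sq_loss big_ord_recr/= [X in _ + X - _]big_ord_recr/= eqxx.
rewrite [X in _ - _ * X + _]big_ord_recr/= eqxx.
under eq_bigr do rewrite big_ord_recr/= eqxx (wn _).
under eq_bigr do under eq_bigr do rewrite wn.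
under [X in _ + (X + _) - _]eq_bigr do rewrite wn kernC.
under [X in _ - _ * (X + _) + _]eq_bigr do rewrite wn.
rewrite big_split/=.
move: IH gq; rewrite /sq_loss -natr1.
have /andP[_ k1] := kern_itv q q.
lra.
Qed.

Lemma energy_small n : (0 < n)%N -> exists2 y : 'I_n -> R,
  forall i, 0 <= y i <= pi & energy nu y <= 2 / n%:R.
Proof.
move=> n0; have [w uw wn] := herding n.
have nR0 : 0 < n%:R :> R by rewrite ltr0n.
exists (fun i => angle (w i)); first by move=> i; exact: angle_itv.
have -> : (fun i : 'I_n => angle (w i)) = (fun i => fold (angle (w i))).
  by apply/funext => i; rewrite fold_id// angle_itv.
rewrite -loss_fold//.
have -> : (fun i : 'I_n => fold_point (angle (w i))) = (fun i => w i).
  by apply/funext => i; rewrite fold_pointE fold_id ?angle_itv// -upper_half_circleE.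
rewrite lossE.
have -> : n%:R^-1 ^+ 2 * (\sum_(i < n) \sum_(j < n) kern (w i) (w j)) -
  2 / n%:R * (\sum_(i < n) pot nu (w i)) + self_pot nu = n%:R ^- 2 * sq_loss n w.
  by rewrite /sq_loss; field; rewrite gt_eqF.
rewrite (_ : 2 / n%:R = n%:R ^- 2 * (2 * n%:R)); last by field; rewrite gt_eqF.
by rewrite ler_wpM2l// invr_ge0 exprn_ge0// ltW.
Qed.

End herding.

(** * The gradient of the objective *)

Section gradient.
Context {R : realType}.
Variable nu : probability (R * R)%type R.
Hypothesis hnu : measure_support nu `<=` @upper_half_circle R.
Variable n : nat.
Hypothesis n0 : (0 < n)%N.
Implicit Types theta : 'rV[R]_n.

Let G := @objective R nu fold_point n.

Lemma derivable_norm (x : R) : x != 0 -> derivable (fun y : R => `|y|) x 1.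
Proof.
rewrite neq_lt => /orP[x0|x0].
  apply: (@near_eq_derivable _ _ _ (fun y : R => - y)) => //.
  by near=> y; rewrite ltr0_norm//; near: y; exact: lt_nbhsl.
apply: (@near_eq_derivable _ _ _ id) => //.
by near=> y; rewrite gtr0_norm//; near: y; exact: lt_nbhsr.
Unshelve. all: by end_near. Qed.

Lemma differentiable_coord_comp (f : R -> R) theta (i : 'I_n) :
  derivable f (theta ord0 i) 1 -> differentiable (fun t : 'rV[R]_n => f (t ord0 i)) theta.
Proof.
move=> df; apply: (@differentiable_comp _ _ _ _ (fun t : 'rV[R]_n => t ord0 i) f).
  exact: differentiable_coord.
exact/derivable1_diffP.
Qed.

Definition regular (t : 'I_n -> R) :=
  [/\ forall i, sin (t i) != 0,
      forall i, @pmf _ _ _ nu angle (fold (t i)) = 0 &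
      forall i j, i != j -> fold (t i) != fold (t j)].

Lemma regular_differentiable theta : regular (theta ord0) -> differentiable G theta.
Proof.
move=> [t1 t2 t3].
have dfold i : differentiable (fun t : 'rV[R]_n => fold (t ord0 i)) theta.
  by apply: differentiable_coord_comp; exact: derivable_fold.
have dV i : differentiable (fun t : 'rV[R]_n => mean_dist nu (fold (t ord0 i))) theta.
  apply: (@differentiable_comp _ _ _ _ (fun t : 'rV[R]_n => fold (t ord0 i)) (mean_dist nu)) => //.
  by apply/derivable1_diffP; exact: mean_dist_derivable.
have dN i j : differentiable (fun t : 'rV[R]_n => `|fold (t ord0 i) - fold (t ord0 j)|) theta.
  have [<-|ij] := eqVneq i j.
    rewrite (_ : (fun _ => _) = cst 0); first exact: differentiable_cst.
    by apply/funext => t; rewrite subrr normr0.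
  apply: (@differentiable_comp _ _ _ _ (fun t : 'rV[R]_n => fold (t ord0 i) - fold (t ord0 j))
     (fun x : R => `|x|)).
    exact: differentiableB.
  by apply/derivable1_diffP/derivable_norm; rewrite subr_eq0 t3.
rewrite (_ : G = (fun t => self_pot nu - 1 / 2 + (pi * n%:R)^-1 *
     (\sum_i (fun i (t : 'rV[R]_n) => mean_dist nu (fold (t ord0 i))) i) t
   - (2 * pi * n%:R ^+ 2)^-1 * (\sum_i
     (fun i => \sum_j (fun j (t : 'rV[R]_n) => `|fold (t ord0 i) - fold (t ord0 j)|) j) i) t)); last first.
  apply/funext => t; rewrite /G objectiveE// /energy !fct_sumE.
  by congr (_ + _ * _ - _ * _); apply: eq_bigr => i _; rewrite fct_sumE.
apply: differentiableB.
  apply: differentiableD; first exact: differentiable_cst.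
  by apply: differentiableZ; apply: differentiable_sum.
apply: differentiableZ; apply: differentiable_sum => i.
by apply: differentiable_sum.
Qed.

(** A sequence of difference quotients allows both passing to the limit in inequalities and, being
    countable, a measurable version of the gradient. *)
Lemma derive_seq (V : normedModType R) (f : V -> R) a v : derivable f a v ->
  (fun m => m.+1%:R * (f (m.+1%:R^-1 *: v + a) - f a)) @ \oo --> 'D_v f a.
Proof.
move=> /cvg_ex[l fl]; have -> : 'D_v f a = l by exact: cvg_lim.
have h : (fun m : nat => m.+1%:R^-1 : R) @ \oo --> 0^'.
  move=> A A0; have [N _ hN] := @cvg_harmonic R _ A0; exists N => // m Nm.
  apply: (hN m Nm).
  by suff: m.+1%:R^-1 != 0 :> R by []; rewrite invr_eq0 pnatr_eq0.
have := cvg_comp _ _ h fl; apply: cvg_trans; apply: near_eq_cvg.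
by near=> m; rewrite /= invrK.
Unshelve. all: by end_near. Qed.

(* The gradient wherever the objective is differentiable; as a limit superior of
   measurable functions it is moreover measurable everywhere. *)
Definition drift theta (i : 'I_n) : R :=
  limn_sup (fun m => m.+1%:R * (G (m.+1%:R^-1 *: delta_mx ord0 i + theta) - G theta)).

Lemma driftE theta i : differentiable G theta ->
  drift theta i = 'D_(delta_mx ord0 i) G theta.
Proof.
move=> dG; have /derive_seq h : derivable G theta (delta_mx ord0 i).
  exact: diff_derivable.
by rewrite /drift cvg_limn_supE; [exact/cvg_lim|apply/cvg_ex; exists ('D_(delta_mx ord0 i) G theta)].
Qed.

Lemma difference_quotient_le theta i m :
  `|m.+1%:R * (G (m.+1%:R^-1 *: delta_mx ord0 i + theta) - G theta)| <= n%:R^-1.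
Proof.
rewrite normrM ger0_norm// -ler_pdivlMl//.
rewrite /G !objectiveE//; apply: le_trans (energy_lipschitz _ _ _ n0) _.
rewrite mulrC ler_wpM2r ?invr_ge0//.
rewrite (bigD1 i)//= big1 => [|j ji]; last first.
  by rewrite !mxE eqxx/= (negbTE ji) mulr0 add0r subrr normr0.
rewrite addr0 (le_trans (fold_lipschitz _ _))//.
by rewrite !mxE !eqxx/= mulr1 addrK ger0_norm.
Qed.

Lemma derive_le theta i : differentiable G theta ->
  `|'D_(delta_mx ord0 i) G theta| <= n%:R^-1.
Proof.
move=> dG; have /derive_seq h : derivable G theta (delta_mx ord0 i).
  exact: diff_derivable.
have hn : (fun m => `|m.+1%:R * (G (m.+1%:R^-1 *: delta_mx ord0 i + theta) - G theta)|)
    @ \oo --> `|'D_(delta_mx ord0 i) G theta| by exact: cvg_norm h.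
rewrite -(cvg_lim _ hn)//; apply: limr_le.
  by apply/cvg_ex; eexists; exact: hn.
by near=> m; exact: difference_quotient_le.
Unshelve. all: by end_near. Qed.

Lemma derive_sum theta (u : 'I_n -> R) : differentiable G theta ->
  'D_(\row_i u i) G theta = \sum_i u i * 'D_(delta_mx ord0 i) G theta.
Proof.
move=> dG; rewrite deriveE// (row_sum_delta (\row_i u i)) linear_sum.
apply: eq_bigr => i _; rewrite linearZ/= mxE deriveE//.
Qed.

(* Reading the target z in the branch of the folding map that contains theta
   makes the energy convex along the segment. *)
Lemma gradient_ineq theta (z : 'I_n -> R) : differentiable G theta ->
  (forall i, 0 <= z i <= pi) ->
  (forall i j, 0 <= (fold (theta ord0 i) - fold (theta ord0 j)) * (z i - z j)) ->
  \sum_i fold_sign (theta ord0 i) * (z i - fold (theta ord0 i))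
     * 'D_(delta_mx ord0 i) G theta <=
  energy nu z - energy nu (fun i => fold (theta ord0 i)).
Proof.
move=> dG z0 yz; pose y i := fold (theta ord0 i).
pose u i := fold_sign (theta ord0 i) * (z i - y i).
rewrite -/(y _) -(derive_sum u)//.
have /derive_seq h : derivable G theta (\row_i u i) by exact: diff_derivable.
rewrite -(cvg_lim _ h)//; apply: limr_le; first by apply/cvg_ex; eexists; exact: h.
near=> m; pose t : R := m.+1%:R^-1.
have t0 : 0 < t by rewrite invr_gt0.
have t1 : t <= 1 by rewrite invf_le1// ler1n.
rewrite -ler_pdivlMl// -/t.
(* The point (1 - t) y + t z stays in [0, pi], so unfolding the displaced theta gives exactly this
   point. *)
have -> : G (t *: \row_i u i + theta) = energy nu (fun i => (1 - t) * y i + t * z i).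
  rewrite /G objectiveE//; congr energy; apply/funext => i; rewrite !mxE.
  rewrite addrC mulrCA fold_unfold fold_id -/(y i); first by ring.
  have /andP[y0 y1] := fold_itv (theta ord0 i); have /andP[z0' z1] := z0 i.
  rewrite -/(y i) in y0 y1 *; apply/andP; split; nra.
have := energy_convex nu n0 (_ : 0 <= t <= 1) yz => /(_ _)/wrap[].
  by rewrite ltW.
rewrite /G objectiveE// -/y; lra.
Unshelve. all: by end_near. Qed.

End gradient.

(** * One step of PGD *)

Section matching.
Context {R : realType} {n : nat}.
Implicit Types (y z : 'I_n -> R) (s : {perm 'I_n}).

Definition cost s y z : R := \sum_i (y i - z (s i)) ^+ 2.

(** n times the squared 2-Wasserstein distance of the two empirical measures. The default of the
    minimum is the cost of the identity, itself a candidate. *)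
Definition match_dist y z : R :=
  \big[Num.min/cost 1%g y z]_(s : {perm 'I_n}) cost s y z.

Definition opt_match s y z : bool := cost s y z <= match_dist y z.

Lemma match_dist_le s y z : match_dist y z <= cost s y z.
Proof. exact: bigmin_le. Qed.

Lemma opt_match_ex y z : exists s, opt_match s y z.
Proof.
have /bigmin_leP := lexx (match_dist y z).
by move=> [h|[s _ h]]; [exists 1%g|exists s].
Qed.

Lemma match_dist_ge0 y z : 0 <= match_dist y z.
Proof.
have [s] := opt_match_ex y z; apply: le_trans.
by apply: sumr_ge0 => i _; rewrite sqr_ge0.
Qed.

Lemma match_dist_refl y : match_dist y y = 0.
Proof.
apply/eqP; rewrite eq_le match_dist_ge0 andbT (le_trans (match_dist_le 1%g _ _))//.
by rewrite /cost big1// => i _; rewrite perm1 subrr expr0n.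
Qed.

Lemma match_dist_bound y z : (forall i, 0 <= y i <= pi) ->
  (forall i, 0 <= z i <= pi) -> match_dist y z <= n%:R * pi ^+ 2.
Proof.
move=> y0 z0; apply: le_trans (match_dist_le 1%g _ _) _.
apply: (@le_trans _ _ (\sum_(i < n) pi ^+ 2)).
  apply: ler_sum => i _; rewrite perm1.
  have /andP[? ?] := y0 i; have /andP[? ?] := z0 i; nra.
by rewrite sumr_const card_ord mulr_natl.
Qed.

(** Exchange argument: swapping the partners of i and j changes the cost by 2 (y_i - y_j)(z_(s i) -
    z_(s j)), which optimality makes nonnegative. *)
Lemma opt_match_mono s y z : opt_match s y z ->
  forall i j, 0 <= (y i - y j) * (z (s i) - z (s j)).
Proof.
move=> so i j; have [->|ij] := eqVneq i j; first by rewrite subrr mul0r.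
have := le_trans so (match_dist_le (tperm i j * s)%g y z).
rewrite /cost (bigD1 i)//= (bigD1 j)/= 1?eq_sym//.
rewrite [X in _ <= X](bigD1 i)//= [X in _ <= _ + X](bigD1 j)/= 1?eq_sym//.
rewrite !permM tpermL tpermR.
rewrite [X in _ <= _ + (_ + X)](eq_bigr (fun k => (y k - z (s k)) ^+ 2)); last first.
  by move=> k /andP[ki kj]; rewrite permM tpermD// eq_sym.
nra.
Qed.

(* Any optimal matching would do; averaging over all of them makes the matched
   target a measurable function of y and z. *)
Definition matched y z (i : 'I_n) : R :=
  (\sum_s if opt_match s y z then z (s i) else 0) /
  (\sum_s if opt_match s y z then 1 else 0).

Lemma opt_match_count y z : 0 < \sum_s (if opt_match s y z then 1 else 0) :> R.
Proof.
have [s so] := opt_match_ex y z; rewrite (bigD1 s)//= so.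
by rewrite ltr_pwDl// sumr_ge0// => t _; case: ifP.
Qed.

Lemma matched_itv y z i : (forall i, 0 <= z i <= pi) -> 0 <= matched y z i <= pi.
Proof.
move=> z0; have c0 := opt_match_count y z; apply/andP; split.
  rewrite divr_ge0 ?(ltW c0)// sumr_ge0// => s _; case: ifP => // _.
  by case/andP: (z0 (s i)).
rewrite ler_pdivrMr// mulr_sumr; apply: ler_sum => s _.
by case: ifP; rewrite ?mulr1 ?mulr0//; case/andP: (z0 (s i)).
Qed.

End matching.

Section pgd_step.
Context {R : realType}.
Variable nu : probability (R * R)%type R.
Hypothesis hnu : measure_support nu `<=` @upper_half_circle R.
Variable n : nat.
Hypothesis n0 : (0 < n)%N.

Let G := @objective R nu fold_point n.

Variables (theta theta' : 'rV[R]_n) (g : R) (x : 'I_n -> R) (z : 'I_n -> R).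
Hypothesis g0 : 0 <= g.
Hypothesis x1 : forall i, `|x i| <= 1.
Hypothesis z0 : forall i, 0 <= z i <= pi.
Hypothesis dG : differentiable G theta.
Hypothesis thetaE : forall i, theta' ord0 i = theta ord0 i -
  g * ('D_(delta_mx ord0 i) G theta + (Num.sqrt n%:R)^-1 * x i).

Let y i := fold (theta ord0 i).
Let y' i := fold (theta' ord0 i).

Lemma step_opt_match s : opt_match s y z ->
  match_dist y' z <= match_dist y z + 2 * g * (energy nu z - energy nu y)
   + 2 * g * (Num.sqrt n%:R)^-1 *
       (\sum_i fold_sign (theta ord0 i) * (z (s i) - y i) * x i) + 4 * g ^+ 2.
Proof.
move=> so; pose u i := fold_sign (theta ord0 i) * (z (s i) - y i).
pose d i := 'D_(delta_mx ord0 i) G theta.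
pose r : R := (Num.sqrt n%:R)^-1.
have nR : 1 <= n%:R :> R by rewrite ler1n.
have r0 : 0 <= r by rewrite invr_ge0 sqrtr_ge0.
have r2 : r * r = n%:R^-1 by rewrite -invfM -expr2 sqr_sqrtr.
have r1 : r <= 1 by rewrite invf_le1 ?sqrtr_gt0 ?ltr0n// -[leLHS]sqrtr1 ler_wsqrtr.
have grad : \sum_i u i * d i <= energy nu z - energy nu y.
  rewrite -(energy_perm nu z s); apply: gradient_ineq => //.
  by move=> i j; exact: (opt_match_mono so).
have step i : (y' i - z (s i)) ^+ 2 <= (y i - z (s i)) ^+ 2
    + 2 * g * (u i * d i) + 2 * g * r * (u i * x i) + 4 * g ^+ 2 * n%:R^-1.
  (* The target is lifted to the line next to theta; folding both points afterwards can only bring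
     them closer. *)
  have zE : fold (theta ord0 i + u i) = z (s i).
    by rewrite /u fold_unfold addrC subrK fold_id.
  have h : `|y' i - z (s i)| <= `|g * (d i + r * x i) + u i|.
    rewrite -zE; apply: le_trans (fold_lipschitz _ _) _.
    rewrite thetaE -/(d i) -/r -normrN.
    by rewrite le_eqVlt; apply/orP; left; apply/eqP; congr `|_|; ring.
  have uE : (y i - z (s i)) ^+ 2 = u i ^+ 2.
    by rewrite exprMn [fold_sign _ ^+ 2]fold_sign_sqr mul1r -sqrrN opprB.
  rewrite uE -[leLHS]real_normK ?num_real//.
  apply: (@le_trans _ _ ((g * (d i + r * x i) + u i) ^+ 2)).
    by rewrite -[leRHS]real_normK ?num_real// lerXn2r ?nnegrE.
  (* The derivative is at most 1/n = r^2 <= r and the noise term at most r; the sum over the n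
     coordinates then gives the term 4 g^2. *)
  have dx : (d i + r * x i) ^+ 2 <= 4 * n%:R^-1.
    rewrite -real_normK ?num_real//.
    apply: (@le_trans _ _ ((2 * r) ^+ 2)); last first.
      by rewrite -r2 le_eqVlt; apply/orP; left; apply/eqP; ring.
    rewrite lerXn2r ?nnegrE ?mulr_ge0//.
    rewrite (le_trans (ler_normD _ _))// normrM (ger0_norm r0).
    rewrite mulr_natl mulr2n lerD//; last by rewrite ler_piMr.
    rewrite (le_trans (derive_le _ _ _ _))// -r2.
    by rewrite ler_piMr.
  have := ler_wpM2l (sqr_ge0 g) dx.
  rewrite -subr_ge0 => dx'; rewrite -subr_ge0 (le_trans dx')//.
  by rewrite le_eqVlt; apply/orP; left; apply/eqP; ring.
apply: le_trans (match_dist_le s _ _) _.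
apply: (@le_trans _ _ (\sum_i ((y i - z (s i)) ^+ 2
    + 2 * g * (u i * d i) + 2 * g * r * (u i * x i) + 4 * g ^+ 2 * n%:R^-1))).
  by apply: ler_sum => i _; exact: step.
have sumc : \sum_(i < n) 4 * g ^+ 2 * n%:R^-1 = 4 * g ^+ 2.
  by rewrite sumr_const card_ord -[LHS]mulr_natr divfK// pnatr_eq0 -lt0n.
rewrite !big_split/= sumc -!mulr_sumr.
apply: lerD => //; apply: lerD => //; apply: lerD => //.
by rewrite ler_wpM2l// mulr_ge0.
Qed.

(** In the bound of [step_opt_match] only the noise term depends on s, and it does so affinely
    through z (s i); averaging over the optimal s replaces it by [matched]. *)
Lemma pgd_step_match :
  match_dist y' z <= match_dist y z + 2 * g * (energy nu z - energy nu y)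
   + 2 * g * (Num.sqrt n%:R)^-1 *
       (\sum_i fold_sign (theta ord0 i) * (matched y z i - y i) * x i) + 4 * g ^+ 2.
Proof.
have c0 := opt_match_count y z.
set c := \sum_s _ in c0.
rewrite -(ler_pM2l c0) /c mulr_suml.
apply: (@le_trans _ _ (\sum_s if opt_match s y z then
  (match_dist y z + 2 * g * (energy nu z - energy nu y)
   + 2 * g * (Num.sqrt n%:R)^-1 *
       (\sum_i fold_sign (theta ord0 i) * (z (s i) - y i) * x i) + 4 * g ^+ 2) else 0)).
  apply: ler_sum => s _; case: ifPn => so; rewrite ?mul0r// mul1r.
  exact: step_opt_match.
rewrite le_eqVlt; apply/orP; left; apply/eqP.
set A := match_dist y z + 2 * g * (energy nu z - energy nu y) + 4 * g ^+ 2.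
set b := 2 * g * (Num.sqrt n%:R)^-1.
transitivity (c * A + b * (\sum_i fold_sign (theta ord0 i) *
    ((\sum_s if opt_match s y z then z (s i) else 0) - c * y i) * x i)).
  rewrite /c mulr_suml.
  under [X in _ + _ * X]eq_bigr do rewrite mulr_suml -sumrB mulr_sumr mulr_suml.
  rewrite exchange_big/= mulr_sumr -big_split/=.
  apply: eq_bigr => s _; case: ifP => _.
    rewrite mul1r /A /b; set S1 := \sum_i _; set S2 := \sum_i _.
    have -> : S2 = S1 by apply: eq_bigr => i _; rewrite mul1r.
    by ring.
  rewrite mul0r big1 ?mulr0 ?addr0// => i _.
  by rewrite mul0r subrr mulr0 mul0r.
rewrite -/c.
have -> : \sum_i fold_sign (theta ord0 i) *
    ((\sum_s if opt_match s y z then z (s i) else 0) - c * y i) * x i =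
  c * \sum_i fold_sign (theta ord0 i) * (matched y z i - y i) * x i.
  rewrite mulr_sumr; apply: eq_bigr => i _; rewrite /matched -/c.
  by field; rewrite gt_eqF.
by rewrite /A; ring.
Qed.

End pgd_step.

(** * Independence *)

Section past.
Context d (T : measurableType d) (R : realType) (P : probability T R) (I : eqType).
Variables (D : {pred I}) (X : I -> {RV P >-> R}).
Hypothesis indX : mutually_independent P D X.
Variables (J : {pred I}) (i0 : I).
Hypotheses (JD : {subset J <= D}) (i0D : i0 \in D) (i0J : i0 \notin J).

(** A pi-system generating the sigma-algebra of the variables with index in J. *)
Definition cylinder (A : set T) : Prop := exists s : seq I, exists B : I -> set R,
  [/\ uniq s, {subset s <= J}, forall i, measurable (B i) &
      A = \bigcap_(i in [set` s]) (X i @^-1` B i)].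

Lemma cylinder_measurable A : cylinder A -> measurable A.
Proof.
move=> [s [B [_ _ mB ->]]]; apply: fin_bigcap_measurable => // i _.
by rewrite -[X in measurable X]setTI; exact: measurable_funP.
Qed.

Lemma cylinder_setI : setI_closed cylinder.
Proof.
move=> _ _ [s [B [us sJ mB ->]]] [s' [B' [us' s'J mB' ->]]].
exists (undup (s ++ s')).
exists (fun i => (if i \in s then B i else setT) `&` (if i \in s' then B' i else setT)).
split.
- exact: undup_uniq.
- by move=> i; rewrite mem_undup mem_cat => /orP[/sJ|/s'J].
- by move=> i; apply: measurableI; case: ifP.
- apply/seteqP; split => w /=.
    move=> [ws ws'] i /=; rewrite mem_undup mem_cat => _; split.
      by case: ifP => // ?; exact: ws.
    by case: ifP => // ?; exact: ws'.
  move=> h; split => i /= si.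
    have /h[] : [set` undup (s ++ s')] i by rewrite /= mem_undup mem_cat si.
    by rewrite si.
  have /h[_] : [set` undup (s ++ s')] i by rewrite /= mem_undup mem_cat si orbT.
  by rewrite si.
Qed.

Lemma cylinder_indep A B : cylinder A -> measurable B ->
  P (A `&` X i0 @^-1` B) = (P A * P (X i0 @^-1` B))%E.
Proof.
move=> [s [C [us sJ mC ->]]] mB.
have i0s : i0 \notin s by apply: contra i0J => /sJ.
pose C' i := if i == i0 then B else C i.
have C's i : i \in s -> C' i = C i.
  by rewrite /C'; case: eqVneq => // -> i0s'; rewrite i0s' in i0s.
have mC' i : measurable (C' i) by rewrite /C'; case: ifP.
have := indX (s := i0 :: s) _ _ mC'; rewrite /= i0s us => /(_ isT).
have -> : \bigcap_(i in [set` i0 :: s]) (X i @^-1` C' i) =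
    \bigcap_(i in [set` s]) (X i @^-1` C i) `&` X i0 @^-1` B.
  apply/seteqP; split => w /=.
    move=> h; split => [i /= si|].
      have /h : [set` i0 :: s] i by rewrite /= inE si orbT.
      by rewrite /= C's.
    have /h : [set` i0 :: s] i0 by rewrite /= inE eqxx.
    by rewrite /C' eqxx.
  move=> [ws w0] i; rewrite /= inE => /predU1P[->|si].
    by rewrite /C' eqxx.
  by rewrite C's//; exact: ws.
move=> ->; last first.
  by move=> i; rewrite inE => /predU1P[->//|/sJ/JD].
rewrite big_cons {1}/C' eqxx muleC; congr (_ * _)%E.
rewrite (indX us) => [|i /sJ/JD//|//].
by rewrite big_seq [RHS]big_seq; apply: eq_bigr => i si; rewrite C's.
Qed.

(** The space T with a coarser sigma-algebra, as a type of its own, so that being determined by the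
    past is ordinary measurability on it. *)
Definition past := g_sigma_algebraType cylinder.

Lemma past_measurable (A : set T) : <<s cylinder >> A -> measurable A.
Proof.
apply: smallest_sub; first exact: sigma_algebra_measurable.
exact: cylinder_measurable.
Qed.

Lemma measurable_id_past : @measurable_fun _ _ T past setT id.
Proof. by move=> _ A mA; rewrite setTI; exact: past_measurable. Qed.

Lemma measurable_past i : i \in J -> @measurable_fun _ _ past R setT (X i).
Proof.
move=> iJ _ A mA; rewrite setTI; apply: sub_sigma_algebra.
exists [:: i]; exists (fun=> A); split => //.
  by move=> j; rewrite inE => /eqP ->.
by apply/seteqP; split => w /=; [move=> h j /=; rewrite inE => /eqP ->|apply; rewrite /= inE].
Qed.

(** With B fixed, both sides are finite measures in A that agree on the cylinders, a generating
    pi-system. *)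
Lemma past_indep (A : set past) B : measurable A -> measurable B ->
  P ((A : set T) `&` X i0 @^-1` B) = (P (A : set T) * P (X i0 @^-1` B))%E.
Proof.
move=> mA mB.
have mXB : measurable (X i0 @^-1` B).
  by rewrite -[X in measurable X]setTI; exact: measurable_funP.
pose m1 := mrestr P mXB.
have r0 : 0 <= fine (P (X i0 @^-1` B)) by rewrite fine_ge0.
pose m2 := mscale (NngNum r0) P.
have PB : P (X i0 @^-1` B) \is a fin_num by rewrite fin_num_measure.
have m2E C : m2 C = (P C * P (X i0 @^-1` B))%E.
  by rewrite muleC -[X in (X * _)%E](fineK PB).
suff h : m1 A = m2 A by exact: (etrans h (m2E A)).
apply: (@g_sigma_algebra_measure_unique d R T cylinder _ (fun=> setT)) => //.
- exact: cylinder_measurable.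
- move=> _; exists [::]; exists (fun=> setT); split => //.
  by apply/seteqP; split => w.
- by apply/seteqP; split => w // _; exists 0%N.
- exact: cylinder_setI.
- by move=> C cC; apply: etrans (esym (m2E C)); exact: cylinder_indep.
- move=> _.
  exact: (le_lt_trans (probability_le1 P (measurableI _ _ measurableT mXB)) (ltry _)).
Qed.

End past.

(** * The joint law of the past and a new noise variable *)

Section product_law.
Context d d' (T : measurableType d) (T' : measurableType d') (R : realType).
Context (P : probability T R) (Q : probability (measurableTypeR R) R).
Variables (f : T -> T') (X : T -> measurableTypeR R).
Hypotheses (mf : measurable_fun setT f) (mX : measurable_fun setT X).
Hypothesis indep : forall A B, measurable A -> measurable B ->
  P (f @^-1` A `&` X @^-1` B) = (P (f @^-1` A) * Q B)%E.

HB.instance Definition _ := isMeasurableFun.Build _ _ _ _ f mf.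

Definition pair_law w : T' * measurableTypeR R := (f w, X w).

Lemma measurable_pair_law : measurable_fun setT pair_law.
Proof. exact: measurable_fun_pair. Qed.

HB.instance Definition _ :=
  isMeasurableFun.Build _ _ _ _ pair_law measurable_pair_law.

Lemma pair_lawE (A : set (T' * measurableTypeR R)) : measurable A ->
  P (pair_law @^-1` A) = (distribution P f \x Q)%E A.
Proof.
move=> mA; apply/esym.
apply: (@product_measure_unique _ _ _ _ _ (distribution P f) Q
  (distribution P pair_law)) => //.
Qed.

(** The law of the pair is a product, so X can be integrated out with f frozen; this does the work
    of a conditional expectation. *)
Lemma Rint_pair_law (h : T' * measurableTypeR R -> R) : bmeas h ->
  \int[P]_w h (f w, X w) = \int[P]_w \int[Q]_x h (f w, x).
Proof.
move=> bh.
transitivity (\int[distribution P pair_law]_z h z).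
  congr fine; rewrite integral_distribution//.
    by apply/measurable_EFinP; case: bh.
  apply: bmeas_integrable; apply: bmeas_comp bh _; exact: measurable_pair_law.
transitivity (\int[(distribution P f \x Q)%E]_z h z).
  congr fine; apply: eq_measure_integral => A mA _.
  by exact: pair_lawE.
rewrite Rint_fubini_prod//; congr fine.
have bi := bmeas_Rint_r (distribution P f) Q bh.
rewrite integral_distribution//.
  by apply/measurable_EFinP; case: bi.
by apply: bmeas_integrable; apply: bmeas_comp bi _; exact: mf.
Qed.

Lemma pair_law_null (A : set (T' * measurableTypeR R)) : measurable A ->
  (forall t, Q [set x | A (t, x)] = 0%E) -> P [set w | A (f w, X w)] = 0%E.
Proof.
move=> mA A0; have -> : [set w | A (f w, X w)] = pair_law @^-1` A by [].
rewrite pair_lawE// [LHS]integral0_eq// => t _ /=.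
rewrite -(A0 t); congr (Q _); apply/seteqP; split => x; rewrite /xsection/= inE//.
Qed.

End product_law.

(** * Uniform noise, centred and without atoms given the past *)

Section noise.
Context {R : realType}.

(* Clipped noise agrees with the noise almost surely but is bounded everywhere. *)
Definition clip (x : R) : R := Num.max (-1) (Num.min 1 x).

Lemma clip_id x : -1 <= x <= 1 -> clip x = x.
Proof. by move=> /andP[x0 x1]; rewrite /clip (min_idPr x1) (max_idPr x0). Qed.

Lemma clip_itv x : -1 <= clip x <= 1.
Proof. by rewrite /clip le_max lexx/= ge_max ge_min lexx (ltW (ltN11 R)). Qed.

Lemma clip_le1 x : `|clip x| <= 1. Proof. by rewrite ler_norml clip_itv. Qed.

Lemma measurable_clip : measurable_fun [set: measurableTypeR R] clip.
Proof.
apply: measurable_maxr; first exact: measurable_cst.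
by apply: measurable_minr; [exact: measurable_cst|exact: measurable_id].
Qed.

Lemma bmeas_clip : @bmeas _ (measurableTypeR R) R clip.
Proof. by split; [exact: measurable_clip|exists 1; exact: clip_le1]. Qed.

Let U := uniform_prob (ltN11 R).

Lemma Rint_clip : \int[U]_x clip x = 0.
Proof.
have b1 : @bmeas _ (measurableTypeR R) R (fun=> 1) by exact: bmeas_cst.
have bc := bmeas_clip.
(* Adding 1 makes the integrand nonnegative, as the passage to Lebesgue measure requires. The
   reflection of [-1, 1] exchanges s = 1 and s = -1, so the two means agree and the mean of [clip]
   is 0. *)
have h (s : R) : `|s| = 1 -> (\int[U]_x (1 + s * clip x)%:E =
    (1 - -1)^-1%:E * \int[lebesgue_measure]_(x in `[(-1)%R, 1%R]) (1 + s * x)%:E)%E.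
  move=> s1; rewrite integral_uniform.
  - congr (_ * _)%E; apply: eq_integral => x; rewrite inE/= in_itv/= => x1.
    by rewrite clip_id.
  - by apply/measurable_EFinP; case: (bmeasD b1 (bmeasZ s bc)).
  - move=> x; rewrite lee_fin -lerBlDl sub0r.
    have : `|s * clip x| <= 1 by rewrite normrM s1 mul1r clip_le1.
    by rewrite ler_norml => /andP[].
have h1 := h 1 (normr1 _).
have h2 := h (-1) (etrans (normrN _) (normr1 _)).
have : (\int[U]_x (1 + 1 * clip x)%:E = \int[U]_x (1 + -1 * clip x)%:E)%E.
  rewrite h1 h2; congr (_ * _)%E.
  have := @integration_by_substitution_oppr R (fun x => 1 + 1 * x) (-1) 1.
  rewrite opprK => -> //; last first.
    apply: continuous_subspaceT => x; apply: cvgD; first exact: cvg_cst.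
    by apply: cvgM; [exact: cvg_cst|exact: cvg_id].
  by apply: eq_integral => x _ /=; rewrite mul1r mulN1r.
rewrite !Rint_EFin; try by apply: bmeasD => //; exact: bmeasZ.
move=> [] ; rewrite !RintD//; try exact: bmeasZ.
rewrite !RintZ// !RintC; lra.
Qed.

End noise.

Section past_noise.
Context d (T : measurableType d) (R : realType) (P : probability T R) (I : eqType).
Variables (D : {pred I}) (X : I -> {RV P >-> R}).
Hypothesis indX : mutually_independent P D X.
Variables (J : {pred I}) (i0 : I).
Hypotheses (JD : {subset J <= D}) (i0D : i0 \in D) (i0J : i0 \notin J).
Hypothesis unifX : forall A, measurable A ->
  distribution P (X i0) A = uniform_prob (ltN11 R) A.

Let U := uniform_prob (ltN11 R).
Let past_T := past X J.

Let mX : @measurable_fun _ _ T (measurableTypeR R) setT (X i0).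
Proof.
have h : measurable_fun setT (X i0) by exact: measurable_funPT.
by move=> mT B mB; exact: h.
Qed.

Let indep A B : measurable A -> measurable B ->
  P ((id : T -> past_T) @^-1` A `&` X i0 @^-1` B) =
  (P ((id : T -> past_T) @^-1` A) * U B)%E.
Proof.
move=> mA mB; apply: etrans (past_indep indX JD i0D i0J mA mB) _.
congr (_ * _)%E; exact: unifX.
Qed.

Lemma past_noise_mean0 (u : past_T -> R) : bmeas u ->
  \int[P]_w (u w * clip (X i0 w)) = 0.
Proof.
move=> bu.
have bh : @bmeas _ (past_T * measurableTypeR R)%type R (fun z => u z.1 * clip z.2).
  apply: bmeasM; first by apply: bmeas_comp bu _; exact: measurable_fst.
  by apply: bmeas_comp (bmeas_clip) _; exact: measurable_snd.
have := Rint_pair_law (@measurable_id_past _ _ _ _ _ X J) mX indep bh.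
move=> /= ->.
under eq_Rintegral do rewrite (RintZ U _ bmeas_clip) Rint_clip mulr0.
exact: RintC.
Qed.

(** With the past frozen, a countable section is null for Lebesgue measure, hence for the uniform
    law. *)
Lemma past_noise_null (A : set (past_T * measurableTypeR R)) : measurable A ->
  (forall t, countable [set x | A (t, x)]) -> P [set w | A (w, X i0 w)] = 0%E.
Proof.
move=> mA cA.
apply: (pair_law_null (@measurable_id_past _ _ _ _ _ X J) mX indep mA) => t.
have mAt : @measurable _ (measurableTypeR R) [set x | A (t, x)].
  by have := measurable_xsection t mA; congr measurable;
    apply/seteqP; split => x; rewrite /xsection/= inE.
have /null_content_dominatesP := dominates_uniform_prob (ltN11 R); apply => //.
exact: countable_lebesgue_measure0.
Qed.

End past_noise.

(** * Measurability *)

Lemma countableU (T : Type) (A B : set T) :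
  countable A -> countable B -> countable (A `|` B).
Proof.
move=> cA cB; rewrite -bigcup2E; apply: bigcup_countable => // -[|[|i]] _ //=.
Qed.

(** * Countability of the fibres of the folding map *)

Section fold_fibres.
Context {R : realType}.

Lemma foldN (t : R) : fold (- t) = fold t.
Proof. by rewrite /fold cosN. Qed.

Lemma fold_fibre (t : R) : exists k : nat, exists b c : bool,
  t = (-1) ^+ b * (pi *+ 2 *+ k + (-1) ^+ c * fold t).
Proof.
wlog t0 : t / 0 <= t.
  move=> h; have [t0|/ltW t0] := leP 0 t; first exact: h.
  have [|k [b [c e]]] := h (- t); first by rewrite oppr_ge0.
  exists k, (~~ b), c; apply: oppr_inj; rewrite -[fold t]foldN {1}e.
  by case: b e => _ /=; rewrite ?expr0 ?expr1; ring.
have pi0 := pi_gt0 R.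
have p2 : 0 < pi *+ 2 :> R by rewrite mulrn_wgt0.
set p := pi *+ 2 in p2 *.
(* Division of t by 2 pi, with remainder s in [0, 2 pi[. *)
pose k := Num.trunc (t / p).
have /andP[k0 k1] : k%:R <= t / p < k.+1%:R by rewrite truncn_itv// divr_ge0// ltW.
pose s := t - p *+ k.
have ts : t = s + p *+ k by rewrite subrK.
have s0 : 0 <= s by rewrite subr_ge0 -mulr_natl -ler_pdivlMr.
have s1 : s < p.
  by rewrite ltrBlDr -mulrS -mulr_natl -ltr_pdivrMr.
have fts : fold t = fold s by rewrite /fold ts periodicn//; exact: cosD2pi.
have [spi|spi] := leP s pi.
  exists k, false, false; rewrite !expr0 !mul1r fts fold_id ?s0//.
  by rewrite addrC.
(* A remainder s above pi folds to p - s, and t = p (k + 1) - (p - s). *)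
exists k.+1, false, true; rewrite expr0 mul1r expr1 mulN1r fts -foldN.
have -> : fold (- s) = p - s.
  rewrite /fold -[cos (- s)]cosD2pi -/(fold _) -/p addrC fold_id// .
  by rewrite subr_ge0 ltW//= lerBlDr /p mulr2n lerD2l ltW.
by rewrite {1}ts mulrS; ring.
Qed.

Lemma countable_fold_affine (S : set R) (a c : R) : c != 0 -> countable S ->
  countable [set x | S (fold (a - c * x))].
Proof.
move=> c0 cS.
pose g (p : nat * (bool * bool)) (y : R) : R :=
  (-1) ^+ p.2.1 * (pi *+ 2 *+ p.1 + (-1) ^+ p.2.2 * y).
apply: (@sub_countable _ _ _
  (\bigcup_(y in S) \bigcup_p [set (a - g p y) / c])); last first.
  by apply: bigcup_countable => // y _; apply: bigcup_countable => // p _; exact: countable1.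
apply: subset_card_le => x /= Sx; exists (fold (a - c * x)) => //.
have [k [b [b' e]]] := fold_fibre (a - c * x).
exists (k, (b, b')) => //=; rewrite /g/= -e.
by field.
Qed.

End fold_fibres.

Section measurability.
Context {R : realType} (nu : probability (R * R)%type R).
Hypothesis hnu : measure_support nu `<=` @upper_half_circle R.
Variable n : nat.
Hypothesis n0 : (0 < n)%N.
Context d (T : measurableType d).

Lemma measurable_mean_dist : measurable_fun setT (mean_dist nu).
Proof.
apply: continuous_measurable_fun; apply: lipschitz1_continuous.
exact: mean_dist_lipschitz.
Qed.

Lemma measurable_energy (y : T -> 'I_n -> R) :
  (forall i, measurable_fun setT (fun w => y w i)) ->
  measurable_fun setT (fun w => energy nu (y w)).
Proof.
move=> my; apply: measurable_funB.
  apply: measurable_funD; first exact: measurable_cst.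
  apply: measurable_funM; first exact: measurable_cst.
  by apply: measurable_sum => i; apply: measurableT_comp (my i); exact: measurable_mean_dist.
apply: measurable_funM; first exact: measurable_cst.
apply: measurable_sum => i; apply: measurable_sum => j.
by apply: measurableT_comp => //; exact: measurable_funB.
Qed.

Lemma measurable_fold_comp (y : T -> R) :
  measurable_fun setT y -> measurable_fun setT (fun w => fold (y w)).
Proof. by move=> my; apply: measurableT_comp my; exact: measurable_fold. Qed.

Lemma measurable_objective (theta : T -> 'rV[R]_n) :
  (forall i, measurable_fun setT (fun w => theta w ord0 i)) ->
  measurable_fun setT (fun w => objective nu fold_point (theta w)).
Proof.
move=> mt; rewrite (_ : (fun w => _) =
    fun w => energy nu (fun i => fold (theta w ord0 i))); last first.
  by apply/funext => w; rewrite objectiveE.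
by apply: measurable_energy => i; exact: measurable_fold_comp.
Qed.

Lemma measurable_drift (theta : T -> 'rV[R]_n) i :
  (forall i, measurable_fun setT (fun w => theta w ord0 i)) ->
  measurable_fun setT (fun w => drift nu (theta w) i).
Proof.
move=> mt; apply: measurable_fun_limn_sup.
- move=> w _; exists n%:R^-1 => _ [m _ <-].
  by have := difference_quotient_le hnu n0 (theta w) i m; rewrite ler_norml => /andP[].
- move=> w _; exists (- n%:R^-1) => _ [m _ <-].
  by have := difference_quotient_le hnu n0 (theta w) i m; rewrite ler_norml => /andP[].
- move=> m; apply: measurable_funM; first exact: measurable_cst.
  apply: measurable_funB; last exact: measurable_objective.
  apply: measurable_objective => j.
  rewrite (_ : (fun w => _) = fun w => m.+1%:R^-1 * ((j == i)%:R : R) + theta w ord0 j).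
    by apply: measurable_funD => //; exact: measurable_cst.
  by apply/funext => w; rewrite !mxE.
Qed.

Lemma measurable_cost (y z : T -> 'I_n -> R) s :
  (forall i, measurable_fun setT (fun w => y w i)) ->
  (forall i, measurable_fun setT (fun w => z w i)) ->
  measurable_fun setT (fun w => cost s (y w) (z w)).
Proof.
by move=> my mz; apply: measurable_sum => i; apply: measurable_funX; exact: measurable_funB.
Qed.

Lemma measurable_match_dist (y z : T -> 'I_n -> R) :
  (forall i, measurable_fun setT (fun w => y w i)) ->
  (forall i, measurable_fun setT (fun w => z w i)) ->
  measurable_fun setT (fun w => match_dist (y w) (z w)).
Proof.
move=> my mz; rewrite /match_dist.
elim: (index_enum _) => [|s r ih].
  under eq_fun do rewrite big_nil; exact: measurable_cost.
under eq_fun do rewrite big_cons; apply: measurable_minr => //; exact: measurable_cost.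
Qed.

Lemma measurable_matched (y z : T -> 'I_n -> R) i :
  (forall i, measurable_fun setT (fun w => y w i)) ->
  (forall i, measurable_fun setT (fun w => z w i)) ->
  measurable_fun setT (fun w => matched (y w) (z w) i).
Proof.
move=> my mz.
have mo s : measurable_fun setT (fun w => opt_match s (y w) (z w)).
  by apply: measurable_fun_ler; [exact: measurable_cost|exact: measurable_match_dist].
apply: measurable_funM.
  apply: measurable_sum => s.
  by apply: measurable_fun_ifT => //; exact: measurable_cst.
under eq_fun do rewrite -powR_inv1 ?(ltW (opt_match_count _ _))//.
apply: (@measurableT_comp _ _ _ _ _ _ (@powR R ^~ (-1))); first exact: measurable_powR.
apply: measurable_sum => s.
by apply: measurable_fun_ifT => //; exact: measurable_cst.
Qed.

End measurability.

(** * The last iterate *)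

Section last_iterate.
Context {R : realType}.

(* Indices are shifted: [step_size m] is gamma_(m + 1). *)
Definition step_size m : R := (Num.sqrt m.+1%:R)^-1.

Lemma step_size_gt0 m : 0 < step_size m.
Proof. by rewrite invr_gt0 sqrtr_gt0. Qed.

(** Factor y^4 - x^4 = 1: the cofactor of y - x has four terms, each at most y^4 because y >= 1. *)
Lemma root4_increment (x y : R) : 0 <= x -> x <= y -> 1 <= y ->
  y ^+ 4 = x ^+ 4 + 1 -> (y ^+ 4)^-1 <= 4 * (y - x).
Proof.
move=> x0 xy y1 e; have y0 : 0 <= y by rewrite (le_trans x0).
have yx : 0 <= y - x by rewrite subr_ge0.
have y4 : 0 < y ^+ 4 by rewrite exprn_gt0// (lt_le_trans ltr01).
have t1 : y ^+ 2 * x <= y ^+ 4.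
  by rewrite (exprD y 2 2) ler_wpM2l ?sqr_ge0// (le_trans xy)// ler_eXnr.
have t2 : y * x ^+ 2 <= y ^+ 4.
  rewrite (exprD y 1 3) expr1 ler_wpM2l// (@le_trans _ _ (y ^+ 2))//.
    by rewrite lerXn2r ?nnegrE.
  by rewrite ler_weXn2l.
have t3 : x ^+ 3 <= y ^+ 4.
  by rewrite (@le_trans _ _ (y ^+ 3)) ?lerXn2r ?nnegrE// ler_weXn2l.
have t0 : y ^+ 3 <= y ^+ 4 by rewrite ler_weXn2l.
rewrite -[leLHS]mul1r ler_pdivrMr//.
rewrite [leLHS](_ : 1 = (y - x) * (y ^+ 3 + y ^+ 2 * x + y * x ^+ 2 + x ^+ 3)); last first.
  by transitivity (y ^+ 4 - x ^+ 4); [rewrite e; ring|ring].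
rewrite [leRHS](_ : _ = (y - x) * (4 * y ^+ 4)); last by ring.
by rewrite ler_wpM2l//; lra.
Qed.

(** The true growth is logarithmic; a fourth root is enough, since multiplied by k^(-1/2) it gives
    the k^(-1/4) that [root4_le] absorbs. *)
Lemma harmonic_le_root4 m :
  \sum_(i < m) i.+1%:R^-1 <= 4 * Num.sqrt (Num.sqrt m%:R) :> R.
Proof.
elim: m => [|m IH]; first by rewrite big_ord0 !sqrtr0 mulr0.
rewrite big_ord_recr/=.
pose f (k : nat) : R := Num.sqrt (Num.sqrt k%:R).
have f4 k : f k ^+ 4 = k%:R.
  by rewrite (_ : 4 = 2 * 2)%N// exprM !sqr_sqrtr ?sqrtr_ge0.
have inc : m.+1%:R^-1 <= 4 * (f m.+1 - f m).
  rewrite -(f4 m.+1); apply: root4_increment.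
  - by rewrite sqrtr_ge0.
  - by rewrite ler_wsqrtr// ler_wsqrtr// ler_nat.
  - by rewrite -[leLHS]sqrtr1 ler_wsqrtr// -[leLHS]sqrtr1 ler_wsqrtr// ler1n.
  - by rewrite !f4 natr1.
by apply: le_trans (lerD IH inc) _; rewrite -/(f m) -/(f m.+1) mulrBr addrC subrK.
Qed.

(* Weighted form of the last-iterate argument of Shamir and Zhang: comparing with
   the iterate s itself shows that dropping s from the average of the iterates
   s, ..., M costs little. *)
Lemma last_iterate_le (a : nat -> R) (b c : R) (M : nat) :
  0 <= c ->
  (forall s, (s <= M)%N -> \sum_(s <= t < M.+1) step_size t * (a t - a s) <=
     2 * \sum_(s <= t < M.+1) step_size t ^+ 2) ->
  (forall s, (s <= M)%N -> \sum_(s <= t < M.+1) step_size t * (a t - b) <=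
     c + 2 * \sum_(s <= t < M.+1) step_size t ^+ 2) ->
  a M <= b + 2 * (c + 2) * step_size M + 32 / Num.sqrt (Num.sqrt M.+1%:R).
Proof.
move=> c0 H1 H2.
pose k : R := M.+1%:R.
pose g := step_size.
pose rho := g M.
have rho0 : 0 < rho by exact: step_size_gt0.
have rhok : rho ^+ 2 = k^-1 by rewrite exprVn sqr_sqrtr.
pose Gam s := \sum_(s <= t < M.+1) g t.
pose S s := \sum_(s <= t < M.+1) g t * a t.
pose B s := \sum_(s <= t < M.+1) g t ^+ 2.
have g0 t : 0 < g t by exact: step_size_gt0.
have g_ge t : (t <= M)%N -> rho <= g t.
  by move=> tM; rewrite lef_pV2 ?posrE ?sqrtr_gt0// ler_wsqrtr// ler_nat.
(* On the second half of the run the steps are comparable with the last one. *)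
have g_le t : (M <= t.*2)%N -> g t ^+ 2 <= 2 * rho ^+ 2.
  move=> Mt; rewrite rhok exprVn sqr_sqrtr// ler_pdivlMr// mulrC ler_pdivrMr//.
  by rewrite -natrM ler_nat mul2n doubleS ltnS leqW.
have cnt (F : R) s : (s <= M.+1)%N -> \sum_(s <= t < M.+1) F = (M.+1 - s)%:R * F.
  by move=> _; rewrite sumr_const_nat mulr_natl.
have Gam_ge s : (s <= M)%N -> (M.+1 - s)%:R * rho <= Gam s.
  move=> sM; rewrite -cnt ?leqW// /Gam !big_nat; apply: ler_sum => t /andP[_ tM].
  exact: g_ge.
have B_le s : (M <= s.*2)%N -> (s <= M)%N -> B s <= (M.+1 - s)%:R * (2 * rho ^+ 2).
  move=> Ms sM; rewrite -cnt ?leqW// /B !big_nat; apply: ler_sum => t /andP[st _].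
  by apply: g_le; rewrite (leq_trans Ms)// leq_double.
have Gam0 s : (s <= M)%N -> 0 < Gam s.
  by move=> sM; apply: lt_le_trans (Gam_ge s sM); rewrite mulr_gt0// ltr0n subn_gt0.
(* Dropping s from the weighted average raises it by at most g_s 2 B_s / (Gam_s Gam_(s+1)), by the
   comparison with iterate s. With N = M + 1 - s, the bounds g_s <= 2 rho, B_s <= 2 N rho^2, Gam_s
   >= N rho and Gam_(s+1) >= (N - 1) rho give the constant 8. *)
have drop s : (M <= s.*2)%N -> (s < M)%N ->
    S s.+1 / Gam s.+1 <= S s / Gam s + 8 * rho / (M - s)%:R.
  move=> Ms sM.
  have sM' := ltnW sM.
  have Sr : S s = g s * a s + S s.+1 by rewrite /S big_ltn// ltnS.
  have Gr : Gam s = g s + Gam s.+1 by rewrite /Gam big_ltn// ltnS.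
  have h : S s - a s * Gam s <= 2 * B s.
    apply: le_trans (H1 s sM'); rewrite /S /Gam mulr_sumr -sumrB.
    by rewrite le_eqVlt; apply/orP; left; apply/eqP; apply: eq_bigr => t _; rewrite -/(g t); ring.
  have Gs := Gam0 s sM'; have Gs1 := Gam0 s.+1 sM.
  have step : S s.+1 / Gam s.+1 <= S s / Gam s + g s * (2 * B s) / (Gam s * Gam s.+1).
    rewrite -subr_ge0.
    have -> : S s / Gam s + g s * (2 * B s) / (Gam s * Gam s.+1) - S s.+1 / Gam s.+1 =
      g s * (2 * B s - (S s - a s * Gam s)) / (Gam s * Gam s.+1).
      rewrite Sr Gr; field; rewrite -Gr; apply/andP; split; exact: lt0r_neq0.
    by rewrite divr_ge0 ?mulr_ge0 ?subr_ge0// ltW.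
  apply: le_trans step _; rewrite lerD2l.
  have d0 : 0 < (M - s)%:R :> R by rewrite ltr0n subn_gt0.
  have d1 : 0 < (M.+1 - s)%:R :> R by rewrite ltr0n subn_gt0 ltnS.
  have Bs := B_le s Ms sM'.
  have G1 := Gam_ge s sM'; have G2 := Gam_ge s.+1 sM; rewrite subSS in G2.
  have gs : g s <= 2 * rho.
    rewrite -(@ler_pXn2r _ 2)// ?nnegrE ?mulr_ge0// ?(ltW (g0 _))// ?(ltW rho0)//.
    apply: le_trans (g_le s Ms) _; rewrite exprMn; have := sqr_ge0 rho; lra.
  rewrite ler_pdivrMr ?mulr_gt0//.
  apply: (@le_trans _ _ (2 * rho * (2 * ((M.+1 - s)%:R * (2 * rho ^+ 2))))).
    apply: ler_pM => //; first exact/ltW.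
      by rewrite mulr_ge0// sumr_ge0// => t _; rewrite sqr_ge0.
    by rewrite ler_wpM2l.
  apply: (@le_trans _ _ (8 * rho / (M - s)%:R *
      (((M.+1 - s)%:R * rho) * ((M - s)%:R * rho)))).
    rewrite le_eqVlt; apply/orP; left; apply/eqP; field; exact: lt0r_neq0.
  apply: ler_wpM2l; first by rewrite divr_ge0 ?mulr_ge0// ltW.
  by apply: ler_pM => //; rewrite mulr_ge0// ltW.
have chain j : (M <= (M - j).*2)%N -> (j <= M)%N ->
    a M <= S (M - j)%N / Gam (M - j)%N + 8 * rho * \sum_(i < j) i.+1%:R^-1.
  elim: j => [|j IH] Mj jM.
    rewrite subn0 big_ord0 mulr0 addr0 /S /Gam !big_nat1 mulrC mulKf//.
    exact: lt0r_neq0.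
  have jM' := ltnW jM.
  apply: le_trans (IH _ jM') _.
    by rewrite (leq_trans Mj)// leq_double leq_sub2l.
  rewrite big_ord_recr/= mulrDr [X in _ <= _ + X]addrC addrA lerD2r.
  have -> : (M - j = (M - j.+1).+1)%N by rewrite subnSK.
  have := drop (M - j.+1)%N Mj; rewrite subKn//; apply.
  by rewrite ltn_subrL (leq_ltn_trans _ jM).
(* The chain goes back to the middle of the run, where the steps are still comparable and their sum
   is already at least 1 / (2 rho), so that the average itself is good. *)
pose w := M./2.
have Mow : M = (odd M + w.*2)%N by rewrite odd_double_half.
have wM : (w <= M)%N by rewrite Mow -addnn addnA leq_addl.
have Mw : (M - w = odd M + w)%N by rewrite {1}Mow -addnn addnA addnK.
have Ms : (M <= (M - w).*2)%N.
  by rewrite Mw {1}Mow doubleD leq_add2r -addnn leq_addr.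
have sM : (M - w <= M)%N by rewrite leq_subr.
apply: le_trans (chain w Ms wM) _.
set s := (M - w)%N in Ms sM *.
have ws : (M.+1 - s = w.+1)%N by rewrite /s subSn// subKn.
have Gs := Gam0 s sM.
have Gw : w.+1%:R * rho <= Gam s by rewrite -ws; exact: Gam_ge.
have Bw : B s <= w.+1%:R * (2 * rho ^+ 2) by rewrite -ws; exact: B_le.
have kw : k <= 2 * w.+1%:R.
  by rewrite -natrM ler_nat mul2n doubleS ltnS {1}Mow -add1n leq_add2r leq_b1.
have kr : k * rho ^+ 2 = 1 by rewrite rhok mulfV// pnatr_eq0.
have Gr : 1 <= 2 * rho * Gam s.
  apply: (@le_trans _ _ (2 * rho * (w.+1%:R * rho))).
    rewrite -[leLHS]kr [leRHS](_ : _ = (2 * w.+1%:R) * rho ^+ 2); last by ring.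
    by rewrite ler_wpM2r// sqr_ge0.
  by rewrite ler_wpM2l// mulr_ge0// ltW.
have avg : S s / Gam s <= b + 2 * (c + 2) * rho.
  rewrite ler_pdivrMr//.
  have h : S s - b * Gam s <= c + 2 * B s.
    apply: le_trans (H2 s sM); rewrite /S /Gam mulr_sumr -sumrB.
    by rewrite le_eqVlt; apply/orP; left; apply/eqP; apply: eq_bigr => t _; rewrite -/(g t); ring.
  have h1 : c <= c * (2 * rho * Gam s) by rewrite ler_peMr.
  have h2 : 2 * B s <= 4 * rho * Gam s.
    apply: (@le_trans _ _ (4 * rho * (w.+1%:R * rho))); first by lra.
    by rewrite ler_wpM2l// mulr_ge0// ltW.
  rewrite (_ : (b + 2 * (c + 2) * rho) * Gam s =
    b * Gam s + (c * (2 * rho * Gam s) + 4 * rho * Gam s)); last by ring.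
  by move: h h1 h2; lra.
apply: lerD => //.
pose q := Num.sqrt (Num.sqrt k).
have q0 : 0 < q by rewrite !sqrtr_gt0 ltr0n.
have rq : rho = q^-1 * q^-1.
  by rewrite -invfM -expr2 sqr_sqrtr ?sqrtr_ge0.
(* Since rho = 1 / q^2, this equals 32 / q. *)
apply: (@le_trans _ _ (8 * rho * (4 * q))).
  apply: ler_wpM2l; first by rewrite mulr_ge0// ltW.
  apply: le_trans (harmonic_le_root4 w) _; apply: ler_wpM2l => //.
  by rewrite ler_wsqrtr// ler_wsqrtr// ler_nat leqW.
rewrite rq -/k -/q le_eqVlt; apply/orP; left; apply/eqP; field.
exact: lt0r_neq0.
Qed.

(* The fourth root in [last_iterate_le] is absorbed by AM-GM. *)
Lemma root4_le (n k : R) : 0 < n -> 0 < k ->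
  (Num.sqrt (Num.sqrt k))^-1 <= (n / Num.sqrt k + n^-1) / 2.
Proof.
move=> n0 k0; set q := Num.sqrt _.
have q0 : 0 < q by rewrite !sqrtr_gt0.
have -> : Num.sqrt k = q ^+ 2 by rewrite sqr_sqrtr ?sqrtr_ge0.
rewrite -subr_ge0.
have -> : (n / q ^+ 2 + n^-1) / 2 - q^-1 = (n / q - 1) ^+ 2 / (2 * n).
  by field; rewrite !lt0r_neq0.
by rewrite divr_ge0 ?sqr_ge0// mulr_ge0// ltW.
Qed.

End last_iterate.

(** * The iterates of PGD *)

Section iterates.
Context {R : realType} (nu : probability (R * R)%type R).
Hypothesis hnu : measure_support nu `<=` @upper_half_circle R.
Variable n : nat.
Hypothesis n0 : (0 < n)%N.
Variable theta1 : 'rV[R]_n.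

(* Indices are shifted: [iterate x m] is the iterate number m + 1. *)
Fixpoint iterate (x : nat -> 'I_n -> R) m : 'rV[R]_n :=
  if m is m'.+1 then
    \row_i (iterate x m' ord0 i - step_size m' *
      (drift nu (iterate x m') i + (Num.sqrt n%:R)^-1 * clip (x m i)))
  else theta1.

(** Over an arbitrary measurable space, and with only the noise of times 1 to m assumed measurable,
    so that it applies to the ambient sigma-algebra as well as to [before]. *)
Lemma measurable_iterate d (T : measurableType d) (X : nat -> 'I_n -> T -> R) m :
  (forall j l, (0 < j <= m)%N -> measurable_fun setT (X j l)) ->
  forall i, measurable_fun setT (fun w => iterate (fun j l => X j l w) m ord0 i).
Proof.
elim: m => [|m IH] mX i; first exact: measurable_cst.
rewrite /=; under eq_fun do rewrite mxE.
have mI j : measurable_fun setT (fun w => iterate (fun j l => X j l w) m ord0 j).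
  by apply: IH => k l /andP[k0 km]; apply: mX; rewrite k0 leqW.
apply: measurable_funB => //; apply: measurable_funM; first exact: measurable_cst.
apply: measurable_funD; first exact: measurable_drift.
apply: measurable_funM; first exact: measurable_cst.
apply: measurable_maxr; first exact: measurable_cst.
apply: measurable_minr; first exact: measurable_cst.
by apply: mX; rewrite leqnn.
Qed.

Context d (T : measurableType d) (P : probability T R).
Variable xi : nat -> 'I_n -> {RV P >-> R}.
Hypothesis noise : pgd_noise xi.

Definition tau m w : 'rV[R]_n := iterate (fun k i => xi k i w) m.

Lemma measurable_tau m i : measurable_fun setT (fun w => tau m w ord0 i).
Proof. by apply: measurable_iterate => j l _; exact: measurable_funPT. Qed.

Lemma ae_clip k i : (0 < k)%N -> {ae P, forall w, clip (xi k i w) = xi k i w}.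
Proof.
move=> k0; have [_ /(_ k i k0) unif] := noise.
pose N : set R := ~` `[-1, 1]%classic.
have mN : measurable N by apply: measurableC; exact: measurable_itv.
have UN : uniform_prob (ltN11 R) N = 0%E.
  pose N' : set (measurableTypeR R) := N.
  have mN' : measurable N' by [].
  have : (\int[uniform_prob (ltN11 R)]_x (\1_N' x)%:E = 0)%E.
    rewrite integral_uniform.
    - rewrite integral0_eq ?mule0// => x; rewrite /= => x1.
      by rewrite indicE memNset//; apply.
    - by apply/measurable_EFinP; exact: measurable_indic.
    - by move=> x; rewrite lee_fin.
  by rewrite integral_indic// setIT.
have PN : P ((xi k i) @^-1` N) = 0%E by rewrite -UN -unif.
exists ((xi k i) @^-1` N); split => //.
  by rewrite -[X in measurable X]setTI; exact: measurable_funPT.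
move=> w /= cw; rewrite /N/= => x1; apply: cw; apply: clip_id.
by move: x1; rewrite in_itv.
Qed.

Let X (ki : nat * 'I_n) := xi ki.1 ki.2.
Let D : {pred nat * 'I_n} := [pred ki : nat * 'I_n | 0 < ki.1]%N.
Let J m i : {pred nat * 'I_n} :=
  [pred ki : nat * 'I_n | (0 < ki.1 <= m.+1)%N && (ki != (m.+1, i))].

Let JD m i : {subset J m i <= D}.
Proof. by move=> ki /andP[/andP[]]. Qed.

Let i0D m i : (m.+1, i) \in D. Proof. by []. Qed.

Let i0J m i : (m.+1, i) \notin J m i.
Proof. by rewrite inE eqxx andbF. Qed.

Let indX : mutually_independent P D X. Proof. by case: noise. Qed.

Let unifX m i A : measurable A ->
  distribution P (X (m.+1, i)) A = uniform_prob (ltN11 R) A.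
Proof. by case: noise => _; apply. Qed.

(* Events determined by all the noise up to time m + 1 except xi_i at time m + 1. *)
Definition before m i := past X (J m i).

Lemma before_tau m i s l : (s <= m)%N ->
  @measurable_fun _ _ (before m i) R setT (fun w => tau s w ord0 l).
Proof.
move=> sm; apply: (@measurable_iterate _ (before m i) (fun k l => xi k l)) => k j /andP[k0 ks].
apply: (@measurable_past _ _ _ _ _ X (J m i) (k, j)).
rewrite inE /= k0 (leq_trans ks)/=; last exact: leqW.
by rewrite xpair_eqE negb_and ltn_eqF// ltnS (leq_trans ks).
Qed.

(** The reason why [before] keeps the other noise of the same time: a collision of i and j is
    excluded through the noise of i, with coordinate j of the same iterate frozen. *)
Lemma before_tau_other m i j : i != j ->
  @measurable_fun _ _ (before m i) R setT (fun w => tau m.+1 w ord0 j).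
Proof.
move=> ij; rewrite /tau/=; under eq_fun do rewrite mxE.
have mt l := @before_tau m i m l (leqnn m).
apply: measurable_funB => //; apply: measurable_funM; first exact: measurable_cst.
apply: measurable_funD; first exact: (measurable_drift hnu n0).
apply: measurable_funM; first exact: measurable_cst.
apply: measurable_maxr; first exact: measurable_cst.
apply: measurable_minr; first exact: measurable_cst.
apply: (@measurable_past _ _ _ _ _ X (J m i) (m.+1, j)).
by rewrite inE /= leqnn/= xpair_eqE eqxx/= eq_sym.
Qed.

Let base m i w : R := tau m w ord0 i - step_size m * drift nu (tau m w) i.
Let coef m : R := step_size m * (Num.sqrt n%:R)^-1.

Let coef_neq0 m : coef m != 0.
Proof. by rewrite gt_eqF// mulr_gt0 ?step_size_gt0// invr_gt0 sqrtr_gt0 ltr0n. Qed.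

Let before_base m i : @measurable_fun _ _ (before m i) R setT (base m i).
Proof.
have mt l := @before_tau m i m l (leqnn m).
apply: measurable_funB => //; apply: measurable_funM; first exact: measurable_cst.
exact: (measurable_drift hnu n0).
Qed.

Let tauS m w i : tau m.+1 w ord0 i = base m i w - coef m * clip (xi m.+1 i w).
Proof. by rewrite /tau/= mxE /base /coef -/(tau m w); ring. Qed.

(** Given [before m i], coordinate i is affine in its own noise with nonzero slope, so the bad
    values of the noise are countable. Taking f = 0 excludes end points and atoms; taking for f
    another folded coordinate excludes collisions. *)
Lemma ae_fold_notin m i (f : before m i -> R) (S : set R) :
  measurable_fun setT f -> countable S ->
  {ae P, forall w, ~ S (fold (tau m.+1 w ord0 i) - f w)}.
Proof.
move=> mf cS.
have mS : measurable S by apply: countable_measurable.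
(* The noise enters unclipped: [clip] has uncountable fibres, which would spoil the countability of
   the sections. *)
pose F (z : before m i * measurableTypeR R) := fold (base m i z.1 - coef m * z.2) - f z.1.
have mF : measurable_fun setT F.
  apply: measurable_funB.
    apply: measurableT_comp; first exact: measurable_fold.
    apply: measurable_funB.
      by apply: measurableT_comp; [exact: before_base|exact: measurable_fst].
    by apply: measurable_funM; [exact: measurable_cst|exact: measurable_snd].
  by apply: measurableT_comp; [exact: mf|exact: measurable_fst].
have mA : measurable (F @^-1` S).
  by rewrite -[X in measurable X]setTI; exact: mF.
have A0 : P [set w | (F @^-1` S) (w, xi m.+1 i w)] = 0%E.
  apply: (past_noise_null indX (@JD m i) (i0D m i) (i0J m i) (@unifX m i) mA) => t.
  rewrite /F/=; apply: (@sub_countable _ _ _ [set x | [set y | S (y - f t)] (fold (base m i t - coef m * x))]).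
    exact: subset_card_le.
  apply: countable_fold_affine; first exact: coef_neq0.
  apply: (@sub_countable _ _ _ (\bigcup_(s in S) [set s + f t])).
    by apply: subset_card_le => y /= Sy; exists (y - f t) => //=; rewrite subrK.
  by apply: bigcup_countable => // s _; exact: countable1.
have neg : P.-negligible [set w | (F @^-1` S) (w, xi m.+1 i w)].
  apply/negligibleP => //.
  have mp : @measurable_fun _ _ T (before m i * measurableTypeR R)%type setT (fun w => (w, xi m.+1 i w)).
    apply: measurable_fun_pair; first exact: measurable_id_past.
    have h : measurable_fun setT (xi m.+1 i) by exact: measurable_funPT.
    by move=> mT B mB; exact: h.
  have := mp measurableT _ mA; rewrite setTI; exact.
have aeneg : {ae P, forall w, ~ (F @^-1` S) (w, xi m.+1 i w)}.
  by apply: negligibleS neg => w /= /contrapT.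
have := ae_clip i (ltn0Sn m); apply: filterS2 aeneg => w/= nS cw.
rewrite tauS cw; exact: nS.
Qed.

Lemma ae_regular m : {ae P, forall w, regular nu (tau m.+1 w ord0)}.
Proof.
pose C : set R := [set y | 0 < @pmf _ _ _ nu angle y] `|` ([set 0] `|` [set pi]).
have cC : countable C.
  rewrite /C; apply: countableU; first exact: pmf_gt0_countable.
  by apply: countableU; exact: countable1.
have h1 : {ae P, forall w, forall i, ~ C (fold (tau m.+1 w ord0 i))}.
  apply: filter_forall => i.
  have := @ae_fold_notin m i (fun=> 0) C (measurable_cst _) cC.
  by apply: filterS => w; rewrite subr0.
have h2 : {ae P, forall w, forall ij : 'I_n * 'I_n, ij.1 != ij.2 ->
    fold (tau m.+1 w ord0 ij.1) != fold (tau m.+1 w ord0 ij.2)}.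
  apply: filter_forall => -[i j] /=.
  have [->|ij] := eqVneq i j; first by apply: filterE => w; rewrite eqxx.
  have mf : @measurable_fun _ _ (before m i) R setT (fun w => fold (tau m.+1 w ord0 j)).
    by apply: measurable_fold_comp; exact: before_tau_other.
  have := ae_fold_notin mf (countable1 0).
  by apply: filterS => w nw _; rewrite -subr_eq0; apply/eqP.
apply: filterS2 h1 h2 => w w1 w2; split => [i|i|i j].
- apply/negP => /eqP si; apply: (w1 i).
  have := sin_fold (tau m.+1 w ord0 i); rewrite si normr0.
  have := fold_itv (tau m.+1 w ord0 i).
  move: (fold _) => y /andP[]; rewrite 2!le_eqVlt => /predU1P[<-|y0]; first by right; left.
  move=> /predU1P[->|y1]; first by right; right.
  by have := @sin_gt0_pi R y; rewrite y0 y1 => /(_ isT) /[swap] ->; rewrite ltxx.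
- apply/eqP; rewrite eq_le pmf_ge0 andbT leNgt; apply/negP => h.
  by apply: (w1 i); left.
- exact: (w2 (i, j)).
Qed.

Hypothesis theta1_diff : differentiable (@objective R nu fold_point n) theta1.

Lemma ae_differentiable m :
  {ae P, forall w, differentiable (@objective R nu fold_point n) (tau m w)}.
Proof.
case: m => [|m]; first by apply: filterE => w.
by apply: filterS (ae_regular m) => w; exact: regular_differentiable.
Qed.

(** Induction on time: almost surely [tau] stays where the gradient exists, so the recursion binds
    the run at each step and forces the same value. *)
Lemma ae_run (theta : nat -> 'I_n -> {RV P >-> R}) m :
  pgd_run (@objective R nu fold_point n) (fun k => (Num.sqrt k%:R)^-1) xi theta1 theta ->
  {ae P, forall w, row_of (fun i => theta m.+1 i) w = tau m w}.
Proof.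
move=> [run1 runS]; elim: m => [|m IH]; first by apply: filterE => w; exact: run1.
have hc : {ae P, forall w, forall i, clip (xi m.+1 i w) = xi m.+1 i w}.
  by apply: filter_forall => i; exact: ae_clip.
apply: filterS3 IH (ae_differentiable m) hc => w IH dw cw.
apply/rowP => i; rewrite /tau/= -/(tau m w) !mxE runS//; last by rewrite IH.
by rewrite IH -IH mxE IH cw driftE.
Qed.

Definition fold_tau m w i := fold (tau m w ord0 i).

Lemma fold_tau_itv m w i : 0 <= fold_tau m w i <= pi.
Proof. exact: fold_itv. Qed.

Lemma measurable_fold_tau m i : measurable_fun setT (fun w => fold_tau m w i).
Proof. by apply: measurable_fold_comp; exact: measurable_tau. Qed.

Lemma bmeas_energy (z : T -> 'I_n -> R) :
  (forall i, measurable_fun setT (fun w => z w i)) ->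
  (forall w i, 0 <= z w i <= pi) -> bmeas (fun w => energy nu (z w)).
Proof.
move=> mz z0; split; first exact: measurable_energy.
by exists 1 => w; have /andP[? ?] := energy_itv hnu n0 (z0 w); rewrite ger0_norm.
Qed.

Lemma bmeas_match_dist (y z : T -> 'I_n -> R) :
  (forall i, measurable_fun setT (fun w => y w i)) ->
  (forall i, measurable_fun setT (fun w => z w i)) ->
  (forall w i, 0 <= y w i <= pi) -> (forall w i, 0 <= z w i <= pi) ->
  bmeas (fun w => match_dist (y w) (z w)).
Proof.
move=> my mz y0 z0; split; first exact: measurable_match_dist.
exists (n%:R * pi ^+ 2) => w; rewrite ger0_norm ?match_dist_ge0//.
exact: match_dist_bound.
Qed.

(** The target z may be random provided it is known before each noise variable of this step; the
    coefficient of that variable is then determined by the past and the noise term has mean 0. *)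
Lemma mean_step m (z : T -> 'I_n -> R) :
  (forall i l, @measurable_fun _ _ (before m i) R setT (fun w => z w l)) ->
  (forall w i, 0 <= z w i <= pi) ->
  \int[P]_w match_dist (fold_tau m.+1 w) (z w) <=
  \int[P]_w match_dist (fold_tau m w) (z w)
  + 2 * step_size m * (\int[P]_w energy nu (z w) - \int[P]_w energy nu (fold_tau m w))
  + 4 * step_size m ^+ 2.
Proof.
move=> mz z0; set g := step_size m.
have g0 : 0 <= g by exact/ltW/step_size_gt0.
have mzT l : measurable_fun setT (fun w => z w l).
  pose i := Ordinal n0.
  have := measurableT_comp (mz i l) (@measurable_id_past _ _ _ _ _ X (J m i)).
  exact.
pose u i w := fold_sign (tau m w ord0 i) * (matched (fold_tau m w) (z w) i - fold_tau m w i).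
have bu i : @bmeas _ (before m i) R (u i).
  have mt l := @before_tau m i m l (leqnn m).
  have mft l : @measurable_fun _ _ (before m i) R setT (fun w => fold_tau m w l).
    exact: measurable_fold_comp.
  split.
    apply: measurable_funM.
      apply: measurable_fun_ifT; [|exact: measurable_cst|exact: measurable_cst].
      apply: measurable_fun_ler; first exact: measurable_cst.
      apply: measurableT_comp (mt i).
      by apply: continuous_measurable_fun; exact: continuous_sin.
    by apply: measurable_funB => //; exact: measurable_matched.
  exists pi => w; rewrite normrM.
  have -> : `|fold_sign (tau m w ord0 i)| = 1.
    by rewrite /fold_sign; case: ifP; rewrite ?normrN normr1.
  have /andP[? ?] := @matched_itv _ _ (fold_tau m w) (z w) i (z0 w).
  have /andP[? ?] := fold_tau_itv m w i.
  by rewrite mul1r ler_norml; apply/andP; split; lra.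
have buT i : @bmeas _ T R (u i).
  exact: bmeas_comp (bu i) (@measurable_id_past _ _ _ _ _ X (J m i)).
pose x i w := clip (xi m.+1 i w).
have bx i : bmeas (x i).
  split.
    have h : measurable_fun setT (xi m.+1 i) by exact: measurable_funPT.
    apply: measurable_maxr; first exact: measurable_cst.
    by apply: measurable_minr; [exact: measurable_cst|exact: h].
  by exists 1 => w; exact: clip_le1.
have noise0 i : \int[P]_w (u i w * x i w) = 0.
  exact: (past_noise_mean0 indX (@JD m i) (i0D m i) (i0J m i) (@unifX m i) (bu i)).
have bD k : bmeas (fun w => match_dist (fold_tau k w) (z w)).
  apply: bmeas_match_dist => //; first by move=> i; exact: measurable_fold_tau.
  by move=> w i; exact: fold_tau_itv.
have bz := bmeas_energy mzT z0.
have bt : bmeas (fun w => energy nu (fold_tau m w)).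
  by apply: bmeas_energy => [i|w i]; [exact: measurable_fold_tau|exact: fold_tau_itv].
have bux : bmeas (fun w => \sum_i u i w * x i w).
  by apply: bmeas_sum => i; exact: bmeasM.
pose r := (Num.sqrt n%:R)^-1 : R.
have b1 : bmeas (fun w => 2 * g * (energy nu (z w) - energy nu (fold_tau m w))).
  by apply: bmeasZ; exact: bmeasB.
have b2 : bmeas (fun w => 2 * g * r * \sum_i u i w * x i w) by exact: bmeasZ.
have b3 : bmeas (fun w => match_dist (fold_tau m w) (z w)
    + 2 * g * (energy nu (z w) - energy nu (fold_tau m w))) by exact: bmeasD.
have b4 : bmeas (fun w => match_dist (fold_tau m w) (z w)
    + 2 * g * (energy nu (z w) - energy nu (fold_tau m w))
    + 2 * g * r * \sum_i u i w * x i w) by exact: bmeasD.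
apply: (@le_trans _ _ (\int[P]_w (match_dist (fold_tau m w) (z w)
    + 2 * g * (energy nu (z w) - energy nu (fold_tau m w))
    + 2 * g * r * (\sum_i u i w * x i w) + 4 * g ^+ 2))).
  apply: Rint_ae_le => //; first by apply: bmeasD => //; exact: bmeas_cst.
  apply: filterS (ae_differentiable m) => w dw.
  apply: (pgd_step_match hnu n0 g0 (x := fun i => x i w) _ (z0 w) dw) => [i|i].
    exact: clip_le1.
  by rewrite /tau/= mxE -/(tau m w) driftE.
rewrite RintD//; last exact: bmeas_cst.
rewrite RintD// RintD// RintC RintZ; last exact: bmeasB.
rewrite RintB// RintZ// Rint_sum; last by move=> i; exact: bmeasM.
by rewrite big1 ?mulr0 ?addr0.
Qed.

Definition mean_energy m : R := \int[P]_w energy nu (fold_tau m w).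

Lemma mean_energy_sum s e (z : T -> 'I_n -> R) : (s <= e)%N ->
  (forall m i l, (s <= m)%N -> @measurable_fun _ _ (before m i) R setT (fun w => z w l)) ->
  (forall w i, 0 <= z w i <= pi) ->
  2 * (\sum_(s <= t < e) step_size t * (mean_energy t - \int[P]_w energy nu (z w))) <=
  \int[P]_w match_dist (fold_tau s w) (z w) + 4 * \sum_(s <= t < e) step_size t ^+ 2.
Proof.
move=> se mz z0; set ez := \int[P]_w energy nu (z w).
pose Dz t := \int[P]_w match_dist (fold_tau t w) (z w).
suff : Dz e + 2 * (\sum_(s <= t < e) step_size t * (mean_energy t - ez)) <=
    Dz s + 4 * \sum_(s <= t < e) step_size t ^+ 2.
  have : 0 <= Dz e by apply: Rintegral_ge0 => w _; exact: match_dist_ge0.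
  rewrite -/(Dz s); lra.
elim: e se => [|e IH]; first by rewrite leqn0 => /eqP ->; rewrite !big_geq// !mulr0.
rewrite leq_eqVlt => /predU1P[<-|]; first by rewrite !big_geq// !mulr0.
rewrite ltnS => se; rewrite !big_nat_recr//=.
have := mean_step (fun i l => mz e i l se) z0.
by move: (IH se); rewrite -/(Dz e) -/(Dz e.+1) -/(mean_energy e) -/ez; lra.
Qed.

(** Two targets enter the last-iterate bound: iterate s itself, at matching distance 0 at time s,
    and the fixed q, at distance at most n pi^2 from any iterate. Halving the latter gives c = n
    pi^2 / 2. *)
Lemma mean_energy_le M (q : 'I_n -> R) : (forall i, 0 <= q i <= pi) ->
  mean_energy M <= energy nu q + (n%:R * pi ^+ 2 + 4) * step_size M
    + 32 / Num.sqrt (Num.sqrt M.+1%:R).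
Proof.
move=> q0; pose c : R := n%:R * pi ^+ 2 / 2.
have c0 : 0 <= c by rewrite divr_ge0// mulr_ge0// sqr_ge0.
rewrite (_ : n%:R * _ + 4 = 2 * (c + 2)); last by rewrite /c; field.
apply: last_iterate_le => // s sM.
  have := @mean_energy_sum s M.+1 (fold_tau s) (leqW sM).
  rewrite -/(mean_energy s).
  have -> : \int[P]_w match_dist (fold_tau s w) (fold_tau s w) = 0.
    by under eq_Rintegral do rewrite match_dist_refl; exact: RintC.
  move=> h; have {}h : 2 * (\sum_(s <= t < M.+1) step_size t * (mean_energy t - mean_energy s)) <=
     0 + 4 * \sum_(s <= t < M.+1) step_size t ^+ 2.
    apply: h => [m i l sm|w i]; last exact: fold_tau_itv.
    by apply: measurable_fold_comp; exact: before_tau.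
  lra.
have := @mean_energy_sum s M.+1 (fun=> q) (leqW sM) (fun _ _ _ _ => measurable_cst _) (fun=> q0).
rewrite RintC => h.
have : \int[P]_w match_dist (fold_tau s w) q <= n%:R * pi ^+ 2.
  rewrite -[leRHS](RintC P); apply: Rint_le.
  - apply: bmeas_match_dist => // [i|w i]; first exact: measurable_fold_tau.
    exact: fold_tau_itv.
  - exact: bmeas_cst.
  - by move=> w; apply: match_dist_bound => // i; exact: fold_tau_itv.
by rewrite /c; lra.
Qed.

End iterates.

(** * Admissible starting points and the final bound *)

Lemma countable_avoid (R : realType) (S : set R) (u v : R) :
  countable S -> u < v -> exists x, u < x < v /\ ~ S x.
Proof.
move=> cS uv; apply: contrapT => nex.
have sub : `]u, v[%classic `<=` S.
  move=> x /=; rewrite in_itv/= => xuv; apply: contrapT => nS.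
  by apply: nex; exists x.
have cI : countable (`]u, v[%classic : set R).
  by apply: (sub_countable _ cS); exact: subset_card_le.
have := countable_lebesgue_measure0 cI.
rewrite lebesgue_measure_itv/= lte_fin uv -EFinB => -[] /eqP.
by rewrite subr_eq0 gt_eqF.
Qed.

(** The interval [1, 2] lies in [0, pi], where the folding map is the identity. It is cut into n
    cells, and each open cell contains a point that is not an atom, there being only countably many
    atoms. *)
Lemma admissible_start_ex (R : realType) (nu : probability (R * R)%type R)
    (hnu : measure_support nu `<=` @upper_half_circle R) (n : nat) : (0 < n)%N ->
  exists theta1 : 'rV[R]_n, admissible_start (@objective R nu fold_point n) 1 2 theta1.
Proof.
move=> n0; have nR0 : 0 < n%:R :> R by rewrite ltr0n.
have pi2 := pi_ge2 R.
have avoid (i : 'I_n) : exists x : R,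
    1 + i%:R / n%:R < x < 1 + i.+1%:R / n%:R /\ ~ 0 < @pmf _ _ _ nu angle x.
  apply: countable_avoid; first exact: pmf_gt0_countable.
  by rewrite ltrD2l ltr_pM2r ?invr_gt0// ltr_nat.
pose p i := projT1 (cid (avoid i)).
have p1 (i : 'I_n) : 1 + i%:R / n%:R < p i < 1 + i.+1%:R / n%:R.
  by rewrite /p; case: cid => x [].
have p2 i : @pmf _ _ _ nu angle (p i) = 0.
  rewrite /p; case: cid => x [_ /= /negP]; rewrite -leNgt => h.
  by apply/eqP; rewrite eq_le h pmf_ge0.
have p3 i : 1 < p i < 2.
  have /andP[a b] := p1 i; apply/andP; split.
    by apply: le_lt_trans a; rewrite lerDl divr_ge0.
  apply: lt_le_trans b _; rewrite (_ : 2 = 1 + 1 :> R)// lerD2l.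
  by rewrite ler_pdivrMr// mul1r ler_nat ltn_ord.
have lt_p (i j : 'I_n) : (i < j)%N -> p i < p j.
  move=> ij; have /andP[_ b] := p1 i; have /andP[a _] := p1 j.
  apply: lt_trans b _; apply: le_lt_trans a.
  by rewrite lerD2l ler_pM2r ?invr_gt0// ler_nat.
have injp : injective p.
  move=> i j pij; apply/val_inj/eqP; case: (ltngtP (val i) (val j)) => // /lt_p;
  by rewrite pij ltxx.
have foldp i : fold (p i) = p i.
  have /andP[a b] := p3 i; rewrite fold_id//; apply/andP; split; lra.
exists (\row_i p i); split.
- by move=> i j; rewrite !mxE => /injp.
- by move=> i; rewrite mxE in_itv/=; have /andP[/ltW -> /ltW ->] := p3 i.
- apply: regular_differentiable => //; split => [i|i|i j ij]; rewrite !mxE.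
  + have /andP[a b] := p3 i.
    by rewrite gt_eqF// sin_gt0_pi//; apply/andP; split; lra.
  + by rewrite foldp.
  + by rewrite !foldp (inj_eq injp).
Qed.

Theorem corollary6p4 (R : realType) (nu : probability (R * R)%type R)
    (hnu : measure_support nu `<=` @upper_half_circle R) :
  exists (Psi : R -> R * R) (a b C : R),
    [/\ measurable_fun [set: R] Psi, forall t : R, circle (Psi t), a < b &
    forall n : nat, (0 < n)%N ->
      let G := @objective R nu Psi n in
      (exists theta1 : 'rV[R]_n, admissible_start G a b theta1) /\
      forall theta1 : 'rV[R]_n, admissible_start G a b theta1 ->
      forall (d : measure_display) (T : measurableType d)
             (P : probability T R)
             (xi theta : nat -> 'I_n -> {RV P >-> R}),
      pgd_noise xi ->
      pgd_run G (fun k => (Num.sqrt k%:R)^-1) xi theta1 theta ->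
      forall k : nat, (0 < k)%N ->
        {ae P, forall omega, differentiable G (row_of (theta k) omega)} /\
        ('E_P [fun omega => loss nu (fun i => Psi (theta k i omega))] <=
         (C * (n%:R / Num.sqrt k%:R + n%:R^-1))%:E)%E].
Proof.
(* 36 = 16 + 4 + 16 bounds the coefficient of n / sqrt k: pi^2 <= 16, then 4 <= 4 n, then half of
   the 32 of the fourth-root term. The coefficient of 1/n is only 2 + 16. *)
exists (@fold_point R), 1, 2, 36; split.
- exact: measurable_fold_point.
- exact: circle_fold_point.
- by rewrite ltr1n.
move=> n n0 G; split; first exact: admissible_start_ex.
move=> theta1 [_ _ dG] d T P xi theta noise run [//|M] _.
have aerun := ae_run hnu n0 noise dG M run.
have aediff := ae_differentiable hnu n0 noise dG M.
split; first by apply: filterS2 aerun aediff => w ->.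
have nR0 : 0 < n%:R :> R by rewrite ltr0n.
pose f w := energy nu (fun i => fold (theta M.+1 i w)).
have bf : bmeas f.
  apply: bmeas_energy => // [i|w i]; last exact: fold_itv.
  by apply: measurable_fold_comp; exact: measurable_funPT.
have -> : ('E_P[fun w => loss nu (fun i => fold_point (theta M.+1 i w))] =
    (\int[P]_w f w)%R%:E)%E.
  rewrite unlock -Rint_EFin//; apply: eq_integral => w _.
  by rewrite loss_fold.
rewrite lee_fin.
have -> : \int[P]_w f w = mean_energy nu theta1 xi M.
  apply: Rint_ae_eq => //.
    apply: bmeas_energy => // [i|w i]; last exact: fold_itv.
    exact: measurable_fold_tau.
  apply: filterS aerun => w e; rewrite /f /fold_tau -e; congr (energy nu _).
  by apply/funext => i; rewrite mxE.
have [q q0 qn] := energy_small hnu n0.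
apply: le_trans (mean_energy_le hnu n0 noise dG M q0) _.
have k0 : 0 < M.+1%:R :> R by rewrite ltr0n.
have := root4_le nR0 k0.
have pi4 : pi ^+ 2 <= 16 :> R.
  by have := pihalf_lt2 R; have := pi_ge2 R; move: (pi : R) => p; nra.
have n1 : 1 <= n%:R :> R by rewrite ler1n.
rewrite /step_size; set r := (Num.sqrt M.+1%:R)^-1; set h := (Num.sqrt (Num.sqrt _))^-1.
have r0 : 0 <= r by rewrite invr_ge0 sqrtr_ge0.
have nn : 0 <= n%:R^-1 :> R by rewrite invr_ge0 ltW.
have h1 : n%:R * pi ^+ 2 * r <= 16 * (n%:R * r).
  rewrite (_ : n%:R * pi ^+ 2 * r = pi ^+ 2 * (n%:R * r)); last by ring.
  by rewrite ler_wpM2r// mulr_ge0// ltW.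
have h2 : r <= n%:R * r by rewrite ler_peMl.
move: qn h1 h2 => /=; move: (energy nu q) (n%:R * r) => e nr.
lra.
Qed.
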